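(* Let $\mathcal{E}$ be an infinite-dimensional complex Hilbert space, $N\ge1$, let $\phi$ be a strictly positive unital functional on $\mathcal{P}_N^0=\mathbb{C}\langle Y_1,\ldots,Y_N\rangle$ (with self-adjoint indeterminates), and let $\{\varphi_\sigma\}_{\sigma\in\mathbb{F}_N^+}$ be its orthogonal polynomials. For $n\ge0$ and $W,W'\in\mathcal{G}_N(\mathcal{E})$ define the Christoffel–Darboux kernel $$K_n(W,W')=\sum_{|\sigma|\le n}\varphi_\sigma(W)\varphi_\sigma(W')^*\in\mathcal{L}(\mathcal{E}).$$ Then for all $n\ge0$ and all $W,W'\in\mathcal{G}_N(\mathcal{E})$, $$K_n(W,W')=F(W)\Big(\tfrac{1}{2i}\big(\Phi_{n+1}(W)B_{n,N}\Phi_n(W')^*-\Phi_n(W)B_{n,N}^*\Phi_{n+1}(W')^*\big)\Big)^{\oplus\infty}F(W')^*-\sum_{k=1}^{N-1}F(W)\big(W_kK_n(W,W')(W'_k)^*\big)^{\oplus\infty}F(W')^*.$$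
   Context: Words and polynomials: $\mathbb{F}_N^+$ is the set of words on the letters $1,\ldots,N$, with empty word $\emptyset$ and length $|\sigma|$, ordered by $\preceq$: shorter words first, words of equal length lexicographically. $\mathcal{P}_N^0$ is the algebra of complex polynomials in non-commuting indeterminates $Y_1,\ldots,Y_N$; $Y_\sigma=Y_{i_1}\cdots Y_{i_k}$ for $\sigma=i_1\cdots i_k$, $Y_\emptyset=1$. $\mathcal{I}$ is the conjugate-linear involution with $\mathcal{I}(Y_{i_1}\cdots Y_{i_k})=Y_{i_k}\cdots Y_{i_1}$. A linear functional $\phi$ on $\mathcal{P}_N^0$ is strictly positive and unital if $\phi(1)=1$ and $\phi(\mathcal{I}(P)P)>0$ for $P\neq0$; put $\langle P,Q\rangle_\phi=\phi(\mathcal{I}(Q)P)$. The orthogonal polynomials of $\phi$ are the unique $\varphi_\sigma=\sum_{\tau\preceq\sigma}a_{\sigma,\tau}Y_\tau$ with $a_{\sigma,\sigma}>0$ and $\langle\varphi_\sigma,\varphi_\tau\rangle_\phi=\delta_{\sigma,\tau}$. Matrices: $B_{n,N}$ is the $N^{n+1}\times N^n$ complex matrix with entries $(B_{n,N})_{\tau,\sigma}=\langle Y_N\varphi_\sigma,\varphi_\tau\rangle_\phi$, $|\tau|=n+1$, $|\sigma|=n$. (With $\Phi_n=[\varphi_\sigma]_{|\sigma|=n}$ a row vector, it is the coefficient of $\Phi_{n+1}$ in the three-term recurrence $Y_N\Phi_n=\Phi_{n+1}B_{n,N}+\Phi_nA_{n,N}+\Phi_{n-1}B_{n-1,N}^*$.)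 Evaluation: for $W=(W_1,\ldots,W_N)\in\mathcal{L}(\mathcal{E})^N$ and $P=\sum c_\sigma Y_\sigma$, $P(W)=\sum c_\sigma W_\sigma$ with $W_{i_1\cdots i_k}=W_{i_1}\cdots W_{i_k}$, $W_\emptyset=I$. $\Phi_n(W)=[\varphi_\sigma(W)]_{|\sigma|=n}$ is a row of operators, i.e. an operator $\mathcal{E}^{\oplus N^n}\to\mathcal{E}$; a scalar matrix $B$ between such rows acts as $B\otimes I_{\mathcal{E}}$. Domains: $\mathcal{L}(\mathcal{E})$ is the set of bounded operators on $\mathcal{E}$; for self-adjoint operators, $A<B$ means $B-A\ge\varepsilon I$ for some $\varepsilon>0$. The unit ball is $\mathcal{B}_N(\mathcal{E})=\{Z\in\mathcal{L}(\mathcal{E})^N:\sum_{k=1}^NZ_kZ_k^*<I\}$ and the Siegel upper half-space is $$\mathcal{G}_N(\mathcal{E})=\{W\in\mathcal{L}(\mathcal{E})^N: W_1W_1^*+\cdots+W_{N-1}W_{N-1}^*<\tfrac1{2i}(W_N-W_N^* )\}.$$ For $W\in\mathcal{G}_N(\mathcal{E})$ put $$\mathcal{C}^{-1}(W)=\big(2i(i+W_N)^{-1}W_1,\ldots,2i(i+W_N)^{-1}W_{N-1},(i+W_N)^{-1}(i-W_N)\big)\in\mathcal{B}_N(\mathcal{E}).$$ The operators $E$ and $F$: let $\mathcal{E}_0=\mathcal{E}$, $\mathcal{E}_k=\mathcal{E}_{k-1}^{\oplus N}$, so $\bigoplus_{k\ge0}\mathcal{E}_k$ is the Hilbert space direct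 sum of copies of $\mathcal{E}$ indexed by $\mathbb{F}_N^+$. For $Z\in\mathcal{B}_N(\mathcal{E})$, $E(Z):\bigoplus_{k\ge0}\mathcal{E}_k\to\mathcal{E}$ is the bounded row operator $E(Z)f=\sum_{\sigma}Z_\sigma f_\sigma$. For $T\in\mathcal{L}(\mathcal{E})$, $T^{\oplus\infty}$ is the diagonal operator on $\bigoplus_{k\ge0}\mathcal{E}_k$ with all diagonal entries $T$. For $W\in\mathcal{G}_N(\mathcal{E})$, $$F(W)=2E(\mathcal{C}^{-1}(W))\big((i+W_N)^{-1}\big)^{\oplus\infty}.$$ *)

(* Defs.v *)
From HB Require Import structures.
From mathcomp Require Import all_boot all_order all_algebra.
From mathcomp Require Import all_classical all_reals all_analysis.
From mathcomp.real_closed Require Import complex.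
From mathcomp.finmap Require finmap.
From mathcomp.multinomials Require monalg.
Import -(notations) finmap monalg.

Set Implicit Arguments.
Unset Strict Implicit.
Unset Printing Implicit Defensive.

Import Order.TTheory GRing.Theory Num.Theory.
Import numFieldNormedType.Exports.

Local Open Scope classical_set_scope.
Local Open Scope ring_scope.

(* The inner product is linear in its first argument. *)
HB.mixin Record CompleteNormedModule_isHilbert (R : realType) E
    & CompleteNormedModule R[i] E := {
  hdot : {dot E for (@Num.conj R[i])};
  hdotxx : forall x : E, hdot x x = `|x| ^+ 2 }.

#[short(type="hilbertType")]
HB.structure Definition Hilbert (R : realType) :=
  {E of CompleteNormedModule R[i] E & CompleteNormedModule_isHilbert R E}.

Definition infinite_dim (R : realType) (E : hilbertType R) : Prop :=
  ~ exists s : seq E, forall x : E,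
      exists c : 'I_(size s) -> R[i], x = \sum_(i < size s) c i *: s`_i.

Section Dot.
Variables (C : numClosedFieldType) (U : lmodType C).
Variable dot : {dot U for (@Num.conj C)}.

Lemma dot_CauchySchwarz (u v : U) : `|dot u v| ^+ 2 <= dot u u * dot v v.
Proof.
have [->|v0] := eqVneq v 0.
  by rewrite !linear0r normr0 expr0n /=.
have vv : 0 < dot v v by rewrite dnorm_gt0.
pose a := dot u v / dot v v.
have := dnorm_ge0 dot (u - a *: v).
rewrite dnormB dnormZ linearZr_LR /=.
have -> : a^* = (dot u v)^* / dot v v.
  by rewrite /a rmorphM fmorphV /= (geC0_conj (ltW vv)).
have -> : `|a| ^+ 2 * dot v v = `|dot u v| ^+ 2 / dot v v.
  rewrite /a normrM normfV (ger0_norm (ltW vv)) exprMn exprVn.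
  by rewrite [dot v v ^+ 2]expr2 invfM mulrA mulfVK // gt_eqF.
have e : (dot u v)^* / dot v v * dot u v = `|dot u v| ^+ 2 / dot v v.
  by rewrite mulrAC [_^* * _]mulrC -normCK.
rewrite e.
have -> : (`|dot u v| ^+ 2 / dot v v)^* = `|dot u v| ^+ 2 / dot v v.
  by rewrite geC0_conj // divr_ge0 ?exprn_ge0 // ltW.
rewrite opprD addrA addrK subr_ge0 ler_pdivrMr //.
Qed.

Lemma dot_triangle (u v : U) :
  sqrtC (dot (u + v) (u + v)) <= sqrtC (dot u u) + sqrtC (dot v v).
Proof.
rewrite -ler_sqr ?rpredD ?nnegrE ?sqrtC_ge0 // ?addr_ge0 ?sqrtC_ge0 //.
rewrite sqrrD !sqrtCK addrAC dnormD lerD2l.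
have cs : `|dot u v| <= sqrtC (dot u u) * sqrtC (dot v v).
  rewrite -ler_sqr ?nnegrE ?mulr_ge0 ?sqrtC_ge0 //.
  by rewrite exprMn !sqrtCK dot_CauchySchwarz.
have -> : dot u v + (dot u v)^* = 'Re (dot u v) *+ 2.
  by rewrite ReE -mulr_natr divfK // pnatr_eq0.
rewrite lerMn2r /=; apply: le_trans cs.
have [-> //] := leif_Re_Creal (dot u v).
Qed.

Lemma dot_polar (u v : U) : dot u v = 4^-1 *
  (dot (u + v) (u + v) - dot (u - v) (u - v)
   + 'i * (dot (u + 'i *: v) (u + 'i *: v) - dot (u - 'i *: v) (u - 'i *: v))).
Proof.
rewrite !dnormB !dnormD !linearZr_LR /= conjCi.
have e (a b : C) : a + b - (a - b) = b *+ 2.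
  by rewrite opprB [a + b]addrC addrACA subrr addr0 mulr2n.
rewrite !e.
have -> : (- 'i * dot u v)^* = 'i * (dot u v)^*.
  by rewrite rmorphM rmorphN /= conjCi opprK.
have -> : 'i * ((- 'i * dot u v + 'i * (dot u v)^*) *+ 2)
    = (dot u v - (dot u v)^*) *+ 2.
  rewrite mulrnAr mulrDr !mulrA mulrN -expr2 sqrCi opprK mul1r mulN1r.
  by [].
rewrite -mulrnDl addrACA subrr addr0 -mulr2n -mulrnA.
by rewrite -[_ *+ (2 * 2)]mulr_natl mulrA mulVf ?mul1r // pnatr_eq0.
Qed.

End Dot.

Lemma mono_cvg (R : realType) (u : nat -> R[i]^o) (M : R[i]) :
    (forall n, 0 <= u n) -> (forall n, u n <= u n.+1) -> (forall n, u n <= M) ->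
  exists l : R[i]^o, [/\ u @ \oo --> l, forall n, u n <= l &
    forall M' : R[i], (forall n, u n <= M') -> l <= M'].
Proof.
move=> u0 uS uM; pose v n : R := complex.Re (u n).
have uE n : u n = ((v n)%:C)%C by rewrite /v RRe_real // ger0_real.
have MR M' : (forall n, u n <= M') -> M' = ((complex.Re M')%:C)%C.
  by move=> h; rewrite RRe_real // ger0_real // (le_trans (u0 0%N)).
have v_nd : nondecreasing_seq v.
  apply/nondecreasing_seqP => n; rewrite -lecR -!uE; exact: uS.
have v_le M' : (forall n, u n <= M') -> forall n, v n <= complex.Re M'.
  by move=> h n; rewrite -lecR -uE -MR.
have v_ub : has_ubound (range v).
  by exists (complex.Re M) => _ [n _ <-]; exact: v_le.
have cv := nondecreasing_is_cvgn v_nd v_ub.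
exists ((limn v)%:C)%C; split.
- apply/cvgrPdist_lt => e e0.
  have eE : e = ((complex.Re e)%:C)%C by rewrite RRe_real // gtr0_real.
  have e0' : 0 < complex.Re e by rewrite -ltcR -eE.
  near=> n; rewrite uE eE -rmorphB normc_def /= expr0n /= addr0 sqrtr_sqr ltcR.
  by near: n; move/cvgrPdist_lt : cv; exact.
- by move=> n; rewrite uE lecR; exact: nondecreasing_cvgn_le.
- move=> M' h; rewrite (MR M' h) lecR; apply: limr_le => //.
  by near=> n; exact: v_le.
Unshelve. all: by end_near. Qed.

Section LevelSum.
Variable A : finType.

Definition level_sum (V : nmodType) (n : nat) (F : seq A -> V) : V :=
  \sum_(k < n) \sum_(t : k.-tuple A) F t.

Lemma level_sumD (V : nmodType) n (F G : seq A -> V) :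
  level_sum n (fun s => F s + G s) = level_sum n F + level_sum n G.
Proof. by rewrite -big_split; apply: eq_bigr => k _; rewrite big_split. Qed.

Lemma level_sum_morph (V V' : nmodType) (h : V -> V') n (F : seq A -> V) :
  h 0 = 0 -> {morph h : x y / x + y} ->
  level_sum n (fun s => h (F s)) = h (level_sum n F).
Proof.
move=> h0 hD; rewrite /level_sum (big_morph h hD h0).
by apply: eq_bigr => k _; rewrite (big_morph h hD h0).
Qed.

Lemma level_sumM (C : pzSemiRingType) n (a : C) (F : seq A -> C) :
  level_sum n (fun s => a * F s) = a * level_sum n F.
Proof. by rewrite (level_sum_morph (h := *%R a)) ?mulr0 //; exact: mulrDr. Qed.

Lemma eq_level_sum (V : nmodType) n (F G : seq A -> V) :
  F =1 G -> level_sum n F = level_sum n G.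
Proof. by move=> FG; apply: eq_bigr => k _; apply: eq_bigr. Qed.

Variable C : numDomainType.
Implicit Types F G : seq A -> C.

Lemma ler_level_sum n F G :
  (forall s, F s <= G s) -> level_sum n F <= level_sum n G.
Proof. by move=> FG; apply: ler_sum => k _; apply: ler_sum. Qed.

Lemma level_sum_ge0 n F : (forall s, 0 <= F s) -> 0 <= level_sum n F.
Proof. by move=> F0; apply: sumr_ge0 => k _; apply: sumr_ge0. Qed.

Lemma level_sumS n F : (forall s, 0 <= F s) -> level_sum n F <= level_sum n.+1 F.
Proof.
move=> F0; rewrite {2}/level_sum big_ord_recr lerDl.
by apply: sumr_ge0.
Qed.

Lemma level_sum_term F s : (forall s, 0 <= F s) -> F s <= level_sum (size s).+1 F.
Proof.
move=> F0; rewrite /level_sum big_ord_recr /= (bigD1 (in_tuple s)) //=.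
by rewrite addrCA lerDl addr_ge0 // sumr_ge0 // => k _; rewrite sumr_ge0.
Qed.

End LevelSum.

Section HilbertSum.
Variables (R : realType) (A : finType) (E : hilbertType R).
Local Notation C := R[i].

(* hsum below is the Hilbert space direct sum of the copies of E indexed by the
   words over A. Its sums are limits of partial sums over the words of length
   less than n, i.e. over the first n summands of (+)_k E^(#|A|^k). *)
Definition sq_summable (f : seq A -> E) : Prop :=
  exists M : C, forall n, level_sum n (fun s => `|f s| ^+ 2) <= M.

Definition hsum_pred : {pred seq A -> E} := fun f => `[< sq_summable f >].

Lemma sq_ge0 (f : seq A -> E) s : 0 <= `|f s| ^+ 2.
Proof. exact: exprn_ge0. Qed.
Hint Resolve sq_ge0 : core.

Lemma sqnormD (x y : E) : `|x + y| ^+ 2 <= 2 * `|x| ^+ 2 + 2 * `|y| ^+ 2.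
Proof.
have : 0 <= `|x - y| ^+ 2 by exact: exprn_ge0.
rewrite -!hdotxx dnormB dnormD; set d := _ + _^*; set a := _ + _.
rewrite subr_ge0 => h; rewrite -mulrDr mulr_natl mulr2n lerD2l //.
Qed.

Lemma hsum_submod : submod_closed hsum_pred.
Proof.
split.
  apply/asboolP; exists 0 => n.
  by rewrite /level_sum big1 // => k _; rewrite big1 // => t _; rewrite normr0 expr0n.
move=> a f g /asboolP[M hM] /asboolP[N hN]; apply/asboolP.
exists (2 * (`|a| ^+ 2 * M) + 2 * N) => n.
apply: le_trans (lerD (ler_wpM2l _ (ler_wpM2l _ (hM n))) (ler_wpM2l _ (hN n))) => //.
rewrite -!level_sumM -level_sumD; apply: ler_level_sum => s.
by apply: le_trans (sqnormD _ _) _; rewrite normrZ exprMn.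
Qed.
HB.instance Definition _ := GRing.isSubmodClosed.Build C (seq A -> E) hsum_pred
  hsum_submod.

Record hsum : predArgType :=
  Hsum { hsum_val :> seq A -> E; _ : hsum_val \in hsum_pred }.
HB.instance Definition _ := [isSub for hsum_val].
HB.instance Definition _ := [Choice of hsum by <:].
HB.instance Definition _ := [SubChoice_isSubLmodule of hsum by <:].


Definition hsum_dot (f g : hsum) : C :=
  lim ((fun n => level_sum n (fun s => hdot (f s) (g s)) : C^o) @ \oo).

Lemma hsum_sq_cvg (f : hsum) : exists l : C^o,
  [/\ (fun n => level_sum n (fun s => hdot (f s) (f s)) : C^o) @ \oo --> l,
      forall n, level_sum n (fun s => hdot (f s) (f s)) <= l &
      forall M : C, (forall n, level_sum n (fun s => hdot (f s) (f s)) <= M) -> l <= M].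
Proof.
have [M hM] : sq_summable f by apply/asboolP; case: f.
apply: (@mono_cvg R _ M) => n.
- by apply: level_sum_ge0 => s.
- by apply: level_sumS => s.
- by apply: le_trans (hM n); apply: ler_level_sum => s; rewrite hdotxx.
Qed.

Lemma hsum_dot_cvg (f g : hsum) :
  (fun n => level_sum n (fun s => hdot (f s) (g s)) : C^o) @ \oo
    --> (hsum_dot f g : C^o).
Proof.
pose S (h : hsum) n : C^o := level_sum n (fun s => hdot (h s) (h s)).
have Sc h : cvg (S h @ \oo).
  by have [l [hl _ _]] := hsum_sq_cvg h; apply/cvg_ex; exists l.
have dE n : level_sum n (fun s => hdot (f s) (g s)) = 4^-1 *:
   (S (f + g) n - S (f - g) n
     + ('i : C) *: (S (f + ('i : C) *: g) n - S (f - ('i : C) *: g) n)) :> C^o.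
  rewrite /S.
  transitivity (level_sum n (fun s => 4^-1 * (hdot ((f + g) s) ((f + g) s)
    + - hdot ((f - g) s) ((f - g) s)
    + 'i * (hdot ((f + ('i : C) *: g) s) ((f + ('i : C) *: g) s)
            + - hdot ((f - ('i : C) *: g) s) ((f - ('i : C) *: g) s))))).
    by apply: eq_level_sum => s; rewrite dot_polar.
  rewrite level_sumM level_sumD level_sumM !level_sumD.
  by rewrite !(level_sum_morph (h := -%R)) ?oppr0 //; exact: opprD.
rewrite /hsum_dot; under eq_fun do rewrite dE.
apply: is_cvgZr; apply: is_cvgD; first exact: is_cvgB.
by apply: is_cvgZr; exact: is_cvgB.
Qed.

Lemma hsum_dot_lim (f g : hsum) (l : C^o) :
  (fun n => level_sum n (fun s => hdot (f s) (g s)) : C^o) @ \oo --> l ->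
  hsum_dot f g = l.
Proof. by move=> h; apply: cvg_lim h; exact: norm_hausdorff. Qed.

Lemma hsum_dot_linearl (g : hsum) :
  GRing.linear_for ( *%R : C -> C -> C) (fun f => hsum_dot f g).
Proof.
move=> a f h; apply: hsum_dot_lim.
have -> : (fun n => level_sum n (fun s => hdot ((a *: f + h) s) (g s)) : C^o)
  = (fun n => a *: (level_sum n (fun s => hdot (f s) (g s)) : C^o)
         + (level_sum n (fun s => hdot (h s) (g s)) : C^o)).
  apply/funext => n; rewrite -[RHS]/(a * level_sum n _ + level_sum n _).
  rewrite -level_sumM -level_sumD.
  by apply: eq_level_sum => s; rewrite linearPl.
by apply: cvgD; [apply: cvgZr|]; exact: hsum_dot_cvg.
Qed.

Lemma hsum_dot_herm (f g : hsum) :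
  hsum_dot f g = (-1) ^+ false * Num.conj (hsum_dot g f).
Proof.
rewrite mul1r; apply: hsum_dot_lim.
have -> : (fun n => level_sum n (fun s => hdot (f s) (g s)) : C^o)
  = (fun n => Num.conj (level_sum n (fun s => hdot (g s) (f s))) : C^o).
  apply/funext => n.
  rewrite -(level_sum_morph (h := Num.conj)) ?rmorph0 //; last exact: rmorphD.
  by apply: eq_level_sum => s; rewrite [LHS]hermC /= expr0 mul1r.
apply/cvgrPdist_lt => e e0.
have /cvgrPdist_lt/(_ e e0) := @hsum_dot_cvg g f.
by apply: filterS => n; rewrite -rmorphB norm_conjC.
Qed.

Lemma hsum_dot_linearr (f : hsum) :
  GRing.linear_for (Num.conj \; *%R : C -> C -> C) (hsum_dot f).
Proof.
move=> a g h; rewrite hsum_dot_herm hsum_dot_linearl.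
by rewrite [hsum_dot f g]hsum_dot_herm [hsum_dot f h]hsum_dot_herm !mul1r rmorphD rmorphM.
Qed.

HB.instance Definition _ := bilinear_isBilinear.Build C hsum hsum C
  ( *%R) (Num.conj \; *%R) hsum_dot (hsum_dot_linearl, hsum_dot_linearr).
HB.instance Definition _ := isHermitianSesquilinear.Build C hsum
  false Num.conj hsum_dot hsum_dot_herm.

Lemma hsum_dot_ge (f : hsum) n :
  level_sum n (fun s => hdot (f s) (f s)) <= hsum_dot f f.
Proof. by have [l [/hsum_dot_lim -> h _]] := hsum_sq_cvg f. Qed.

Lemma hsum_dot_le (f : hsum) (M : C) :
  (forall n, level_sum n (fun s => hdot (f s) (f s)) <= M) -> hsum_dot f f <= M.
Proof. by have [l [/hsum_dot_lim -> _ h]] := hsum_sq_cvg f; exact: h. Qed.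

Lemma hsum_dot_term (f : hsum) s : `|f s| ^+ 2 <= hsum_dot f f.
Proof.
rewrite -hdotxx; apply: le_trans (hsum_dot_ge f (size s).+1).
exact: (level_sum_term (F := fun s => hdot (f s) (f s))).
Qed.

Lemma hsum_dot_gt0 (f : hsum) : f != 0 -> 0 < hsum_dot f f.
Proof.
move=> f0; have [s fs] : exists s, f s != 0.
  apply: contrapT => h; case/eqP: f0; apply/val_inj/funext => s /=.
  by apply: contrapT => /eqP fs; apply: h; exists s.
by apply: lt_le_trans (hsum_dot_term f s); rewrite exprn_gt0 // normr_gt0.
Qed.

HB.instance Definition _ := isDotProduct.Build C hsum hsum_dot hsum_dot_gt0.

Definition hsum_norm (f : hsum) : C := sqrtC (hsum_dot f f).

Lemma hsum_normD (f g : hsum) : hsum_norm (f + g) <= hsum_norm f + hsum_norm g.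
Proof. exact: dot_triangle. Qed.

Lemma hsum_normZ (a : C) (f : hsum) : hsum_norm (a *: f) = `|a| * hsum_norm f.
Proof.
rewrite /hsum_norm dnormZ sqrtCM ?nnegrE ?exprn_ge0 //.
by rewrite sqrCK.
Qed.

Lemma hsum_norm_eq0 (f : hsum) : hsum_norm f = 0 -> f = 0.
Proof. by move/eqP; rewrite sqrt_dnorm_eq0 => /eqP. Qed.

HB.instance Definition _ :=
  Lmodule_isNormed.Build C hsum hsum_normD hsum_normZ hsum_norm_eq0.

Lemma hsum_dotxx (f : hsum) : hsum_dot f f = `|f| ^+ 2.
Proof. by rewrite [`|f|]/(hsum_norm f) sqrtCK. Qed.

Lemma hsum_coord_norm (f : hsum) s : `|f s| <= `|f|.
Proof. by rewrite -ler_sqr ?nnegrE // -hsum_dotxx hsum_dot_term. Qed.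

Lemma level_sum_cvg (T : Type) (F : set_system T) (FF : Filter F) n
    (G : T -> seq A -> C^o) (L : seq A -> C^o) :
  (forall s, (fun t => G t s) @ F --> L s) ->
  (fun t => level_sum n (G t)) @ F --> (level_sum n L : C^o).
Proof.
move=> GL; rewrite /level_sum; apply: cvg_big => //.
  exact: add_continuous.
move=> k _; apply: cvg_big => //; exact: add_continuous.
Qed.

Lemma hsum_complete (F : set_system hsum) : ProperFilter F -> cauchy F -> cvg F.
Proof.
move=> FF /cauchyP Fc.
have cc s : cvg ((fun f : hsum => f s) @ F).
  apply: cauchy_cvg; apply/cauchyP => e e0.
  have [f Ff] := Fc e e0; exists (f s).
  change (F [set g : hsum | ball (f s) e (g s)]).
  apply: filterS Ff => g; rewrite -!ball_normE /= => fg.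
  exact: le_lt_trans (hsum_coord_norm (f - g) s) fg.
pose l s : E := lim ((fun f : hsum => f s) @ F).
have key (e : C) (f : hsum) : 0 < e -> F (ball f e) ->
    forall n, level_sum n (fun s => `|l s - f s| ^+ 2) <= e ^+ 2.
  move=> e0 Ff n; apply/ler_addgt0Pr => d d0.
  have cv : (fun g : hsum => level_sum n (fun s => `|g s - f s| ^+ 2) : C^o) @ F
      --> (level_sum n (fun s => `|l s - f s| ^+ 2) : C^o).
    apply: level_sum_cvg => s.
    have c1 : (fun g : hsum => g s - f s) @ F --> l s - f s.
      by apply: cvgB; [exact: cc | exact: cvg_cst].
    have c2 : (fun g : hsum => `|g s - f s| : C^o) @ F --> (`|l s - f s| : C^o).
      exact: (cvg_norm c1).
    by under eq_fun do rewrite expr2; rewrite expr2; exact: (cvgZ c2 c2).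
  move/cvgrPdist_le : cv => /(_ d d0) cv.
  have [g [/= g1 g2]] := filter_ex (filterI cv Ff).
  have sr h : level_sum n (fun s => `|h s - f s| ^+ 2) \is Num.real.
    by apply: ger0_real; apply: level_sum_ge0 => s; rewrite exprn_ge0.
  rewrite -lerBlDl; apply: le_trans (le_trans (real_ler_norm _) g1).
    rewrite lerD2l lerN2; move: g2; rewrite -ball_normE /= distrC => g2.
    apply: (@le_trans _ _ (`|g - f| ^+ 2)); last first.
      by rewrite ler_sqr ?nnegrE // ?ltW.
    rewrite -hsum_dotxx; apply: le_trans (hsum_dot_ge _ n).
    by apply: ler_level_sum => s; rewrite hdotxx.
  by apply: rpredB; exact: sr.
have lP : l \in hsum_pred.
  have [f Ff] := Fc 1 ltr01.
  rewrite -[l](subrK (f : seq A -> E)); apply: rpredD; last exact: valP.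
  by apply/asboolP; exists (1 ^+ 2); apply: key.
apply/cvg_ex; exists (Hsum lP); apply/cvgrPdist_le => e e0.
have e20 : 0 < e / 2 by rewrite divr_gt0.
have [f Ff] := Fc _ e20; have K := key _ _ e20 Ff.
have lf : `|Hsum lP - f| <= e / 2.
  rewrite -ler_sqr ?nnegrE // ?(ltW e20) // -hsum_dotxx; apply: hsum_dot_le => n.
  by apply: le_trans (K n); apply: ler_level_sum => s; rewrite hdotxx.
apply: filterS Ff => g; rewrite -ball_normE /= => fg.
rewrite (splitr e) -(subrKA f) (le_trans (ler_normD _ _)) // lerD // ltW //.
Qed.

HB.instance Definition _ := Uniform_isComplete.Build hsum hsum_complete.
HB.instance Definition _ :=
  CompleteNormedModule_isHilbert.Build R hsum hsum_dotxx.

End HilbertSum.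

Section BoundedOperators.
Variable R : realType.
Local Notation C := R[i].

Section Module.
Variables U V : hilbertType R.

Definition bounded_linear (T : U -> V) : Prop :=
  linear T /\ exists M : R, forall x, `|T x| <= (M%:C)%C * `|x|.

Definition bop_pred : {pred U -> V} := fun T => `[< bounded_linear T >].

Lemma bop_submod : submod_closed bop_pred.
Proof.
split.
  apply/asboolP; split.
    by move=> a x y; rewrite -[RHS]/(a *: 0 + 0 : V) scaler0 addr0.
  by exists 0 => x; rewrite -[X in `|X|]/(0 : V) normr0 mul0r.
move=> a S T /asboolP[Sl [M hM]] /asboolP[Tl [N hN]]; apply/asboolP; split.
  move=> b x y; rewrite [LHS]/(a *: S _ + T _) Sl Tl !scalerDr !scalerA [a * b]mulrC.
  by rewrite addrACA.
have [r ar] : exists r, `|a| = (r%:C)%C.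
  by exists (complex.Re `|a|); rewrite RRe_real ?normr_real.
exists (r * M + N) => x.
rewrite rmorphD rmorphM mulrDl -mulrA /= -ar.
apply: le_trans (ler_normD _ _) _; apply: lerD => //.
by rewrite normrZ ler_wpM2l.
Qed.
HB.instance Definition _ := GRing.isSubmodClosed.Build C (U -> V) bop_pred
  bop_submod.

Record bop : predArgType := Bop { bop_val :> U -> V; _ : bop_val \in bop_pred }.
HB.instance Definition _ := [isSub for bop_val].
HB.instance Definition _ := [Choice of bop by <:].
HB.instance Definition _ := [SubChoice_isSubLmodule of bop by <:].

Lemma bop_linear (T : bop) : linear T.
Proof. by case: T => T p; have /asboolP[] := p. Qed.
HB.instance Definition _ (T : bop) := GRing.isLinear.Build C U V _ T (bop_linear T).

Lemma bop_bounded (T : bop) : exists M : R, forall x, `|T x| <= (M%:C)%C * `|x|.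
Proof. by case: T => T p; have /asboolP[] := p. Qed.

End Module.

(* By the Riesz representation theorem, exactly one operator satisfies the
   condition, so that the default value 0 is not used. *)
Definition adj (U V : hilbertType R) (T : bop U V) : bop V U :=
  xget 0 [set S : bop V U | forall x y, hdot (T x) y = hdot x (S y)].

Lemma comp_bop_subproof (U V X : hilbertType R) (S : bop V X) (T : bop U V) :
  (S \o T) \in @bop_pred U X.
Proof.
apply/asboolP; split; first by move=> a x y; rewrite /= !linearP.
have [M hM] := bop_bounded S; have [N hN] := bop_bounded T.
exists (`|M| * `|N|) => x /=; rewrite rmorphM /= -mulrA.
have le_norm (K : R) (y : C) : 0 <= y -> (K%:C)%C * y <= (`|K|%:C)%C * y.
  by move=> y0; apply: ler_wpM2r => //; rewrite lecR ler_norm.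
apply: le_trans (hM _) _; apply: le_trans (le_norm M _ _) _ => //.
apply: ler_wpM2l; first by rewrite lecR.
by apply: le_trans (hN _) _; exact: le_norm.
Qed.

Definition comp_bop (U V X : hilbertType R) (S : bop V X) (T : bop U V) : bop U X :=
  Bop (comp_bop_subproof S T).

Lemma id_bop_subproof (U : hilbertType R) : idfun \in @bop_pred U U.
Proof. by apply/asboolP; split => //; exists 1 => x; rewrite mul1r. Qed.

Definition id_bop (U : hilbertType R) : bop U U := Bop (id_bop_subproof U).

Section Ring.
Variable E : hilbertType R.
Implicit Types S T X : bop E E.

Lemma comp_bopA : associative (@comp_bop E E E).
Proof. by move=> S T X; apply/val_inj. Qed.

Lemma comp_id_bop : left_id (id_bop E) (@comp_bop E E E).
Proof. by move=> S; apply/val_inj. Qed.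

Lemma comp_bop_id : right_id (id_bop E) (@comp_bop E E E).
Proof. by move=> S; apply/val_inj. Qed.

Lemma comp_bopDl : left_distributive (@comp_bop E E E) +%R.
Proof. by move=> S T X; apply/val_inj. Qed.

Lemma comp_bopDr : right_distributive (@comp_bop E E E) +%R.
Proof. by move=> S T X; apply/val_inj/funext => x; exact: (linearD S). Qed.

HB.instance Definition _ := GRing.Zmodule_isPzRing.Build (bop E E)
  comp_bopA comp_id_bop comp_bop_id comp_bopDl comp_bopDr.
End Ring.

End BoundedOperators.
Arguments adj {R U V} T.
Infix "∘" := comp_bop (at level 40, left associativity) : ring_scope.

Section Operators.
Variables (R : realType) (E : hilbertType R).
Local Notation C := R[i].

(* Two-sided inverse of an invertible operator (0 if there is none). *)
Definition inv_bop (T : bop E E) : bop E E :=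
  xget 0 [set S : bop E E | S * T = 1 /\ T * S = 1].

(* Only meant for self-adjoint S and T. On R[i], x <= y also says that y - x is
   real. *)
Definition lt_bop (S T : bop E E) : Prop :=
  exists e : R, 0 < e /\
    forall x : E, hdot (((e%:C)%C *: (1 : bop E E)) x) x <= hdot ((T - S) x) x.

Section DirectSum.
Variable A : finType.

Lemma diag_subproof (T : bop E E) (f : hsum A E) :
  (fun s => T (f s)) \in @hsum_pred R A E.
Proof.
have [M hM] := bop_bounded T.
have [N hN] : sq_summable f by apply/asboolP; case: f.
apply/asboolP; exists ((M%:C)%C ^+ 2 * N) => n.
have M2 : 0 <= (M%:C)%C ^+ 2 :> C by rewrite -rmorphXn /= lecR sqr_ge0.
apply: le_trans (ler_wpM2l M2 (hN n)).
rewrite -level_sumM; apply: ler_level_sum => s.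
by rewrite -exprMn lerXn2r ?nnegrE // (le_trans _ (hM _)).
Qed.

Lemma diag_bounded (T : bop E E) :
  (fun f => Hsum (diag_subproof T f)) \in @bop_pred R (hsum A E) (hsum A E).
Proof.
have [M hM] := bop_bounded T; apply/asboolP; split.
  by move=> a f g; apply/val_inj/funext => s; exact: (linearP T).
exists `|M| => f; set g := Hsum _.
have M0 : 0 <= (`|M|%:C)%C :> C by rewrite lecR.
rewrite -ler_sqr ?nnegrE ?mulr_ge0 // exprMn -!(hdotxx (s := hsum A E)).
apply: hsum_dot_le => n.
apply: le_trans (ler_wpM2l (exprn_ge0 2 M0) (hsum_dot_ge f n)).
rewrite -level_sumM; apply: ler_level_sum => s.
rewrite !hdotxx -exprMn lerXn2r ?nnegrE ?mulr_ge0 //.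
by apply: le_trans (hM _) _; rewrite ler_wpM2r // lecR ler_norm.
Qed.

Definition diag_op (T : bop E E) : bop (hsum A E) (hsum A E) := Bop (diag_bounded T).

Definition word_op (Z : A -> bop E E) (s : seq A) : bop E E := \prod_(i <- s) Z i.

(* The row operator f |-> \sum_s Z_s f_s; for Z in the unit ball, where the sum
   converges to a bounded operator, the default value 0 is not used. *)
Definition row_op (Z : A -> bop E E) : bop (hsum A E) E :=
  xget 0 [set T : bop (hsum A E) E | forall f : hsum A E,
    (fun n => level_sum n (fun s => word_op Z s (f s))) @ \oo --> T f].

End DirectSum.

Section Siegel.
(* There are d.+1 variables; the distinguished last one has index ord_max. *)
Variable d : nat.
Implicit Types W : 'I_d.+1 -> bop E E.

Definition siegel W : Prop :=
  lt_bop (\sum_(k | k != ord_max) W k * adj (W k))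
         ((2 * 'i)^-1 *: (W ord_max - adj (W ord_max))).

Definition iW_inv W : bop E E := inv_bop ('i *: (1 : bop E E) + W ord_max).

Definition cayley_inv W : 'I_d.+1 -> bop E E := fun k =>
  if k == ord_max then iW_inv W * ('i *: (1 : bop E E) - W ord_max)
  else (2 * 'i) *: (iW_inv W * W k).

Definition Fop W : bop (hsum 'I_d.+1 E) E :=
  2 *: (row_op (cayley_inv W) ∘ diag_op 'I_d.+1 (iW_inv W)).

End Siegel.
End Operators.

Section OrthogonalPolynomials.
Variables (R : realType) (d : nat).
Local Notation C := R[i].
Local Notation word := (seq 'I_d.+1).

(* malg over the free monoid fmonom is the free algebra. *)
Definition ncpoly := malg (fmonom 'I_d.+1) C.
HB.instance Definition _ := GRing.Lalgebra.on ncpoly.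

Definition Ymon (s : word) : ncpoly := mkmalgU (FMonom s) 1.

(* The conjugate-linear involution that fixes the indeterminates. *)
Definition ncinv (P : ncpoly) : ncpoly :=
  \sum_(m <- msupp P) (mcoeff m P)^* *: Ymon (rev (fmonom_val m)).

Definition ncip (phi : {scalar ncpoly}) (P Q : ncpoly) : C := phi (ncinv Q * P).

Definition strictly_positive_unital (phi : {scalar ncpoly}) : Prop :=
  phi 1 = 1 /\ forall P : ncpoly, P != 0 -> 0 < phi (ncinv P * P).

Definition word_le (s t : word) : bool :=
  (size s < size t)%N ||
  (size s == size t) && ((s : seqlexi 'I_d.+1) <= (t : seqlexi 'I_d.+1))%O.

Definition orthogonal_polys (phi : {scalar ncpoly}) (p : word -> ncpoly) : Prop :=
  [/\ forall s t, mcoeff (FMonom t) (p s) != 0 -> word_le t s,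
      forall s, 0 < mcoeff (FMonom s) (p s) &
      forall s t, ncip phi (p s) (p t) = (s == t)%:R].

Definition word_of n (j : 'I_#|{: n.-tuple 'I_d.+1}|) : word :=
  (enum_val j : n.-tuple 'I_d.+1).

Definition Bmx (phi : {scalar ncpoly}) (p : word -> ncpoly) (n : nat) :
    'M[C]_(#|{: n.+1.-tuple 'I_d.+1}|, #|{: n.-tuple 'I_d.+1}|) :=
  \matrix_(i, j) ncip phi (Ymon [:: ord_max] * p (word_of j)) (p (word_of i)).

Section Evaluation.
Variable E : hilbertType R.
Implicit Types W : 'I_d.+1 -> bop E E.

Definition nceval (P : ncpoly) W : bop E E :=
  \sum_(m <- msupp P) mcoeff m P *: word_op W (fmonom_val m).

(* A row of operators is a matrix over the ring of operators; ampl B is the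
   operator matrix B (x) I. *)
Definition PhiRow (p : word -> ncpoly) (n : nat) W :
    'rV[bop E E]_#|{: n.-tuple 'I_d.+1}| :=
  \row_j nceval (p (word_of j)) W.

Definition adjmx m n (T : 'M[bop E E]_(m, n)) : 'M[bop E E]_(n, m) :=
  (map_mx adj T)^T.

Definition ampl m n (B : 'M[C]_(m, n)) : 'M[bop E E]_(m, n) :=
  map_mx (fun c => c *: (1 : bop E E)) B.

Definition CDkernel (p : word -> ncpoly) (n : nat) W W' : bop E E :=
  \sum_(k < n.+1) \sum_(s : k.-tuple 'I_d.+1)
    nceval (p s) W * adj (nceval (p s) W').

End Evaluation.
End OrthogonalPolynomials.

(* Main.v *)
(* The operators Z_k = (C^-1(W))_k and Z'_k = (C^-1(W'))_k satisfy, for every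
   bounded operator K and with V = (i + W_N)^-1, V' = (i + W'_N)^-1,
     K - sum_k Z_k K Z'_k^*
       = 4 V [(W_N K - K W'_N^* ) / 2i - sum_(k < N) W_k K W'_k^* ] V'^*,
   while F(W) T^(+oo) F(W')^* = sum_s Z_s (4 V T V'^* ) Z'_s^*. Hence, for T the
   operator in brackets, F(W) T^(+oo) F(W')^* telescopes to K, because Z and Z'
   lie in the open unit ball. It remains to evaluate W_N K - K W'_N^* for
   K = K_n(W, W'): expand Y_N phi_s in the orthogonal polynomials; the
   coefficients <Y_N phi_s, phi_t> are Hermitian and vanish when the degrees
   differ by more than one, so only the terms between the levels n and n + 1
   survive, which are the ones gathered in B_(n,N). *)
Require Import Defs.
From HB Require Import structures.
From mathcomp Require Import all_boot all_order all_algebra.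
From mathcomp Require Import all_classical all_reals all_analysis.
From mathcomp.real_closed Require Import complex.
From mathcomp Require Import ring lra.
From mathcomp.finmap Require finmap.
From mathcomp.multinomials Require monalg.
Import -(notations) finmap monalg.
Import Order.TTheory GRing.Theory Num.Theory.
Import numFieldNormedType.Exports.
Local Open Scope classical_set_scope.
Local Open Scope ring_scope.
Set Implicit Arguments.
Unset Strict Implicit.
Unset Printing Implicit Defensive.

(** [adj], [inv_bop] and [row_op] select an operator by its defining property, with default value 0,
    so every algebraic step rests on an existence proof. Adjoints and inverses share one
    minimization argument: it gives the Riesz theorem, and also the surjectivity of an operator
    whose adjoint is bounded below. Membership of [cayley_inv W] in the ball is itself the kernel
    identity, taken at K = 1 and W' = W and made quantitative by the epsilon in the definition of
    the Siegel domain. A uniform constant c < 1 is what the series require: words of length n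
    contribute at most c^(n/2) |f| to the row sum at f. The remainder of the telescoping sum obeys
    the same estimate, because the column of all Z'_s^* x is square-summable, being the value at x
    of the adjoint of a bounded row. On the polynomial side, positivity speaks only of the numbers
    <P, P>; Hermitian symmetry has to be recovered from it by polarization. *)

Lemma ReM_real (K : rcfType) (a : K) (z : K[i]) :
  complex.Re ((a%:C)%C * z) = a * complex.Re z.
Proof. by case: z => u v /=; rewrite mul0r subr0. Qed.

Lemma Re_conj (K : rcfType) (z : K[i]) : complex.Re (z^*) = complex.Re z.
Proof. by case: z. Qed.

(** * Real-valued norm and inner product of a complex Hilbert space *)

Section HilbertNorm.
Variables (R : realType) (E : hilbertType R).
Local Notation C := R[i].

(** Norms take values in [R[i]]; their real parts lie in an ordered field with square roots and
    suprema, where [lra], [nra] and real limits apply. *)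
Definition hnorm (x : E) : R := complex.Re `|x|.

Lemma hnormE (x : E) : `|x| = ((hnorm x)%:C)%C.
Proof. by rewrite [RHS]RRe_real ?normr_real. Qed.

Lemma hnorm_ge0 (x : E) : 0 <= hnorm x.
Proof. by rewrite -lecR -hnormE; exact: normr_ge0. Qed.

Lemma hnorm0 : hnorm 0 = 0.
Proof. by rewrite /hnorm normr0. Qed.

Lemma hnorm_eq0 (x : E) : hnorm x = 0 -> x = 0.
Proof. by move=> x0; apply/eqP; rewrite -normr_eq0 hnormE x0. Qed.

Lemma hnormD (x y : E) : hnorm (x + y) <= hnorm x + hnorm y.
Proof. by rewrite -lecR rmorphD /= -!hnormE ler_normD. Qed.

Lemma hnormN (x : E) : hnorm (- x) = hnorm x.
Proof. by rewrite /hnorm normrN. Qed.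

Lemma hnormB (x y : E) : hnorm (x - y) = hnorm (y - x).
Proof. by rewrite /hnorm distrC. Qed.

Lemma hdotDl (x y z : E) : hdot (x + y) z = hdot x z + hdot y z.
Proof. exact: linearDl. Qed.

Lemma hdotDr (x y z : E) : hdot z (x + y) = hdot z x + hdot z y.
Proof. exact: linearDr. Qed.

Lemma hdotZl (a : C) (x z : E) : hdot (a *: x) z = a * hdot x z.
Proof. by rewrite linearZl_LR. Qed.

Lemma hdotZr (a : C) (x z : E) : hdot z (a *: x) = a^* * hdot z x.
Proof. by rewrite linearZr_LR. Qed.

Lemma hdotBl (x y z : E) : hdot (x - y) z = hdot x z - hdot y z.
Proof. by rewrite linearBl. Qed.

Lemma hdot0l (z : E) : hdot 0 z = 0.
Proof. exact: linear0l. Qed.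

Lemma hdot0r (z : E) : hdot z 0 = 0.
Proof. exact: linear0r. Qed.

Lemma hdotC (x y : E) : hdot x y = (hdot y x)^*.
Proof. by rewrite [LHS]hermC expr0 mul1r. Qed.

Lemma hdot_hnorm (x : E) : hdot x x = ((hnorm x ^+ 2)%:C)%C.
Proof. by rewrite hdotxx hnormE rmorphXn. Qed.

Definition rdot (x y : E) : R := complex.Re (hdot x y).

Lemma rdotxx (x : E) : rdot x x = hnorm x ^+ 2.
Proof. by rewrite /rdot hdot_hnorm. Qed.

Lemma rdotC (x y : E) : rdot x y = rdot y x.
Proof. by rewrite /rdot hdotC Re_conj. Qed.

Lemma rdotDl (x y z : E) : rdot (x + y) z = rdot x z + rdot y z.
Proof. by rewrite /rdot linearDl raddfD. Qed.

Lemma rdotDr (x y z : E) : rdot z (x + y) = rdot z x + rdot z y.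
Proof. by rewrite rdotC rdotDl !(rdotC z). Qed.

Lemma rdotNl (x z : E) : rdot (- x) z = - rdot x z.
Proof. by rewrite /rdot linearNl raddfN. Qed.

Lemma rdotNr (x z : E) : rdot z (- x) = - rdot z x.
Proof. by rewrite rdotC rdotNl rdotC. Qed.

Lemma rdotZl (a : R) (x z : E) : rdot ((a%:C)%C *: x) z = a * rdot x z.
Proof.
by rewrite /rdot linearZl_LR ReM_real.
Qed.

Lemma rdotZr (a : R) (x z : E) : rdot z ((a%:C)%C *: x) = a * rdot z x.
Proof. by rewrite rdotC rdotZl rdotC. Qed.

Lemma hdot0_inj (x : E) : (forall z, hdot z x = 0) -> x = 0.
Proof. by move=> /(_ x)/eqP; rewrite dnorm_eq0 => /eqP. Qed.

Lemma hdot_inj (x y : E) : (forall z, hdot z x = hdot z y) -> x = y.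
Proof.
move=> xy; apply/eqP; rewrite -subr_eq0; apply/eqP/hdot0_inj => z.
by rewrite linearBr /= xy subrr.
Qed.

Lemma rdot_le (x y : E) : rdot x y <= hnorm x * hnorm y.
Proof.
have h (u v : E) (t : R) :
    0 <= hnorm u ^+ 2 - t * 2 * rdot u v + t ^+ 2 * hnorm v ^+ 2.
  have e : hnorm (u - (t%:C)%C *: v) ^+ 2
      = hnorm u ^+ 2 - t * 2 * rdot u v + t ^+ 2 * hnorm v ^+ 2.
    rewrite -!rdotxx rdotDl !rdotDr !rdotNl !rdotNr !rdotZl !rdotZr.
    by rewrite (rdotC v u); ring.
  by rewrite -e sqr_ge0.
have [y0|y0] := eqVneq (hnorm y) 0.
  by rewrite (hnorm_eq0 y0) /rdot linear0r hnorm0 mulr0.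
have yp : 0 < hnorm y by rewrite lt_def y0 hnorm_ge0.
have [x0|x0] := eqVneq (hnorm x) 0.
  by rewrite (hnorm_eq0 x0) /rdot linear0l hnorm0 mul0r.
have xp : 0 < hnorm x by rewrite lt_def x0 hnorm_ge0.
(* This [t] gives [t y] the norm of [x], so that the inequality becomes linear in [rdot x y]. *)
have := h x y (hnorm x / hnorm y).
have -> : (hnorm x / hnorm y) ^+ 2 * hnorm y ^+ 2 = hnorm x ^+ 2.
  by field.
have -> : hnorm x / hnorm y * 2 * rdot x y
    = 2 * hnorm x * (rdot x y / hnorm y) by field.
rewrite -ler_pdivrMr //; set q := _ / _.
by move=> hq; rewrite -(ler_pM2l xp); nra.
Qed.

Lemma hdot_le (x y : E) : `|hdot x y| <= `|x| * `|y|.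
Proof.
rewrite -ler_sqr ?nnegrE ?mulr_ge0 // exprMn -!hdotxx.
exact: dot_CauchySchwarz.
Qed.

Lemma rdot_norm_le (x y : E) : `|rdot x y| <= hnorm x * hnorm y.
Proof.
by rewrite ler_norml rdot_le andbT lerNl -rdotNl (le_trans (rdot_le _ _)) ?hnormN.
Qed.

Lemma cvg_hnorm (T : Type) (F : set_system T) (FF : Filter F) (u : T -> E) (l : E) :
  u @ F --> l <-> (fun t => hnorm (l - u t)) @ F --> (0 : R).
Proof.
split => [/cvgrPdist_lt h|/cvgrPdist_lt h]; apply/cvgrPdist_lt => e e0.
  have e0' : 0 < (e%:C)%C :> C by rewrite ltcR.
  apply: filterS (h _ e0') => t; rewrite hnormE ltcR sub0r normrN.
  by rewrite ger0_norm ?hnorm_ge0.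
have eE : e = ((complex.Re e)%:C)%C by rewrite RRe_real // gtr0_real.
have e0' : 0 < complex.Re e by rewrite -ltcR -eE.
apply: filterS (h _ e0') => t.
by rewrite eE hnormE ltcR sub0r normrN ger0_norm ?hnorm_ge0.
Qed.

(** Cauchy criterion in the form in which the parallelogram law and geometric tails deliver it: a
    bound on squared distances by null sequences. *)
Lemma hilbert_cvg (u : nat -> E) (v : nat -> R) :
  v @ \oo --> (0 : R) -> (forall m n, hnorm (u m - u n) ^+ 2 <= v m + v n) ->
  exists l : E, u @ \oo --> l.
Proof.
move=> v0 uv; apply/cvg_ex; apply: cauchy_cvg; apply/cauchyP => e e0.
have eE : e = ((complex.Re e)%:C)%C by rewrite RRe_real // gtr0_real.
have e0' : 0 < complex.Re e by rewrite -ltcR -eE.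
have e20 : 0 < complex.Re e ^+ 2 / 2 by rewrite divr_gt0 // exprn_gt0.
have /cvgrPdist_lt/(_ _ e20) [N _ hN] := v0.
exists (u N); exists N => // n /= Nn.
rewrite -ball_normE /= hnormE eE ltcR -ltr_sqr ?nnegrE ?hnorm_ge0 ?(ltW e0') //.
have := hN _ (leqnn N); have := hN n Nn; rewrite /= !sub0r !normrN => h1 h2.
apply: le_lt_trans (uv _ _) _; rewrite [ltRHS]splitr.
by apply: ltrD; apply: le_lt_trans (ler_norm _) _.
Qed.

End HilbertNorm.

(** * Minimization of a quadratic functional *)

Section BoundedOperatorTheory.
Variable R : realType.
Local Notation C := R[i].
Implicit Types U V X : hilbertType R.

Lemma bop_hnorm U V (T : bop U V) :
  exists2 M : R, 0 < M & forall x, hnorm (T x) <= M * hnorm x.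
Proof.
have [M hM] := bop_bounded T; exists (`|M| + 1).
  by rewrite ltr_wpDl.
move=> x; have := hM x; rewrite !hnormE -rmorphM lecR => h.
apply: le_trans h _; rewrite ler_wpM2r ?hnorm_ge0 //.
by rewrite (le_trans (ler_norm M)) // lerDl.
Qed.

Lemma bop_cvg U V (T : bop U V) (I : Type) (F : set_system I) (FF : Filter F)
    (u : I -> U) (l : U) : u @ F --> l -> (fun t => T (u t)) @ F --> T l.
Proof.
move=> /cvg_hnorm ul; apply/cvg_hnorm.
have [M M0 hM] := bop_hnorm T.
apply: (@squeeze_cvgr _ _ _ _ (fun=> 0) (fun t => M * hnorm (l - u t))).
- by apply: nearW => t; rewrite hnorm_ge0 -linearB hM.
- exact: cvg_cst.
- by rewrite -[X in _ --> X](mulr0 M); apply: cvgMr.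
Qed.

(* The solution minimizes [|L x|^2 - 2 Re f x]. With [L] the identity this is
   the Riesz representation theorem; with [L] the adjoint of an operator [T] it
   yields the surjectivity of [T]. *)
Lemma bounded_below_representation U V (L : bop U V) (c : R) (f : U -> C) (M : R) :
  {morph f : x y / x + y} -> (forall a x, f (a *: x) = a * f x) ->
  0 < c -> (forall x, hnorm x <= c * hnorm (L x)) ->
  0 < M -> (forall x, complex.Re (f x) <= M * hnorm x) ->
  exists x, forall z, hdot (L z) (L x) = f z.
Proof.
move=> fD fZ c0 hc M0 hM.
have RfD x y : complex.Re (f (x + y)) = complex.Re (f x) + complex.Re (f y).
  by rewrite fD raddfD.
have RfZ (a : R) x : complex.Re (f ((a%:C)%C *: x)) = a * complex.Re (f x).
  by rewrite fZ ReM_real.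
have LZ (a : R) x : L ((a%:C)%C *: x) = (a%:C)%C *: L x by rewrite linearZ.
have LD x y : L (x + y) = L x + L y by rewrite linearD.
have LB x y : L (x - y) = L x - L y by rewrite linearB.
pose J x := hnorm (L x) ^+ 2 - 2 * complex.Re (f x).
(* Completing the square in [|L x|]. *)
have Jlb x : - (M * c) ^+ 2 <= J x.
  have h1 := hM x; have h2 := hc x.
  have h3 : complex.Re (f x) <= M * c * hnorm (L x).
    by apply: le_trans h1 _; rewrite -mulrA ler_wpM2l // ltW.
  have := sqr_ge0 (hnorm (L x) - M * c); rewrite /J; nra.
have Jinf : has_inf (range J).
  by split; [exists (J 0), 0 | exists (- (M * c) ^+ 2) => _ [x _ <-]].
pose d := inf (range J).
have dJ x : d <= J x by apply: ge_inf; [case: Jinf | exists x].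
have JDE (x z : U) (t : R) : J (x + (t%:C)%C *: z) =
    J x + 2 * t * (rdot (L x) (L z) - complex.Re (f z)) + t ^+ 2 * hnorm (L z) ^+ 2.
  rewrite /J RfD RfZ LD LZ -!rdotxx rdotDl !rdotDr !rdotZl !rdotZr.
  by rewrite (rdotC (L z) (L x)); ring.
have /choice[u hu] : forall n, exists x, J x < d + harmonic n.
  move=> n; have := inf_adherent (harmonic_gt0 n) Jinf.
  by case=> _ [x _ <-] ?; exists x.
(* Parallelogram law, with the infimum [d] as lower bound for [J] at the midpoint of [x] and [y]. *)
have Jmid x y : hnorm (L (x - y)) ^+ 2 <= 2 * (J x - d) + 2 * (J y - d).
  have := dJ (((2^-1)%:C)%C *: (x + y)).
  rewrite /J RfZ RfD LZ LD LB -!rdotxx rdotZl rdotZr.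
  rewrite !rdotDl !rdotDr !rdotNl !rdotNr (rdotC (L y) (L x)).
  move=> h; lra.
have c2 : 0 < c ^+ 2 by rewrite exprn_gt0.
have v0 : (fun n => 2 * c ^+ 2 * harmonic n) @ \oo --> (0 : R).
  by rewrite -(mulr0 (2 * c ^+ 2)); apply: cvgMr; exact: cvg_harmonic.
have [|x ux] := @hilbert_cvg R U u _ v0.
  move=> m n; apply: (@le_trans _ _ (c ^+ 2 * hnorm (L (u m - u n)) ^+ 2)).
    by rewrite -exprMn lerXn2r ?nnegrE ?hnorm_ge0 // (le_trans _ (hc _)) ?hnorm_ge0.
  have h1 := hu m; have h2 := hu n; have h3 := Jmid (u m) (u n).
  have -> : 2 * c ^+ 2 * harmonic m + 2 * c ^+ 2 * harmonic n
      = c ^+ 2 * (2 * harmonic m + 2 * harmonic n) by ring.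
  by rewrite ler_pM2l //; lra.
have key z : rdot (L z) (L x) = complex.Re (f z).
  set r := rdot (L x) (L z) - complex.Re (f z); set k := hnorm (L z) ^+ 2.
  have k0 : 0 <= k by rewrite sqr_ge0.
  (* First variation at the minimizer [x], obtained as the limit of the variations at the minimizing
     sequence [u]. *)
  have h t : 0 <= 2 * t * r + t ^+ 2 * k.
    pose w n := hnorm (L x - L (u n)).
    have w0 : w @ \oo --> (0 : R) by apply/cvg_hnorm; exact: bop_cvg ux.
    pose s n := 2 * t * r + t ^+ 2 * k + (harmonic n + 2 * `|t| * hnorm (L z) * w n).
    have s0 : s @ \oo --> 2 * t * r + t ^+ 2 * k.
      rewrite -[X in _ --> X]addr0; apply: cvgD; first exact: cvg_cst.
      rewrite -[X in _ --> X]addr0; apply: cvgD; first exact: cvg_harmonic.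
      by rewrite -(mulr0 (2 * `|t| * hnorm (L z))); apply: cvgMr.
    apply: (cvgr_to_ge s0); apply: nearW => n.
    have h1 := hu n; have := dJ (u n + (t%:C)%C *: z); rewrite JDE -/k => h2.
    have : t * (rdot (L (u n)) (L z) - rdot (L x) (L z)) <= `|t| * (w n * hnorm (L z)).
      apply: le_trans (ler_norm _) _; rewrite normrM ler_wpM2l //.
      rewrite /w hnormB -rdotNl -rdotDl; exact: rdot_norm_le.
    by rewrite /s /r; lra.
  have k1 : 0 < k + 1 by rewrite ltr_wpDl.
  (* The optimal value is [- r / k]; the added 1 allows [k = 0] and still leaves a negative multiple
     of [r ^+ 2]. *)
  have := h (- r / (k + 1)).
  have -> : 2 * (- r / (k + 1)) * r + (- r / (k + 1)) ^+ 2 * k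
      = - (r ^+ 2 * ((k + 2) / (k + 1) ^+ 2)).
    by field; rewrite gt_eqF.
  have kk : 0 < (k + 2) / (k + 1) ^+ 2.
    by rewrite divr_gt0 ?exprn_gt0 // ltr_wpDl.
  rewrite oppr_ge0 pmulr_lle0 // => r2.
  have : r = 0 by apply/eqP; rewrite -sqrf_eq0 eq_le r2 sqr_ge0.
  by rewrite rdotC => /eqP; rewrite subr_eq0 => /eqP.
exists x => z; apply/eqP; rewrite eq_complex -!/(rdot _ _); apply/andP; split.
  exact/eqP/key.
(* The real part at ['i *: z] is the imaginary part at [z], up to sign. *)
have := key (('i : C) *: z); rewrite fZ /rdot linearZ linearZl_LR /=.
rewrite -complexiE mulrC ReiNIm mulrC ReiNIm => /eqP.
by rewrite eqr_opp.
Qed.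

End BoundedOperatorTheory.

(** * Adjoints and inverses of bounded operators *)

Section Adjoint.
Variable R : realType.
Local Notation C := R[i].
Implicit Types U V X E : hilbertType R.

Lemma bop_pred_hnorm U V (T : U -> V) (M : R) :
  linear T -> (forall x, hnorm (T x) <= M * hnorm x) -> T \in @bop_pred R U V.
Proof.
move=> Tl hM; apply/asboolP; split => //; exists M => x.
by rewrite !hnormE -rmorphM lecR.
Qed.

Lemma bopD U V (T : bop U V) x y : T (x + y) = T x + T y.
Proof. exact: linearD. Qed.

Lemma bopB U V (T : bop U V) x y : T (x - y) = T x - T y.
Proof. exact: linearB. Qed.

Lemma bopZ U V (T : bop U V) a x : T (a *: x) = a *: T x.
Proof. exact: linearZ. Qed.

Lemma adjP U V (T : bop U V) x y : hdot (T x) y = hdot x (adj T y).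
Proof.
have [M M0 hM] := bop_hnorm T.
have /choice[S hS] : forall y, exists w, forall z, hdot z w = hdot (T z) y.
  move=> {}y.
  (* The added 1 keeps the bound of the functional positive when [y = 0]. *)
  have y1 : 0 < M * (hnorm y + 1) by rewrite mulr_gt0 // ltr_wpDl ?hnorm_ge0.
  have := @bounded_below_representation R U U (id_bop U) 1
    (fun z => hdot (T z) y) (M * (hnorm y + 1)) _ _ ltr01 _ y1.
  case => //.
  - by move=> u v; rewrite /= linearD hdotDl.
  - by move=> a u; rewrite /= linearZ hdotZl.
  - by move=> u; rewrite mul1r.
  - move=> u; apply: le_trans (rdot_le _ _) _.
    have := hM u; have := hnorm_ge0 y; have := hnorm_ge0 u; nra.
  - by move=> w hw; exists w.
have Sl : linear S.
  move=> a u v; apply: hdot_inj => z; by rewrite hS !hdotDr !hdotZr !hS.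
have SM u : hnorm (S u) <= M * hnorm u.
  have : hnorm (S u) ^+ 2 <= M * hnorm (S u) * hnorm u.
    rewrite -rdotxx /rdot hS; apply: le_trans (rdot_le _ _) _.
    by rewrite ler_wpM2r ?hnorm_ge0.
  have [->|n0] := eqVneq (hnorm (S u)) 0; first by rewrite mulr_ge0 ?hnorm_ge0 // ltW.
  have -> : M * hnorm (S u) * hnorm u = hnorm (S u) * (M * hnorm u) by ring.
  by rewrite expr2 ler_pM2l // lt_def n0; exact: hnorm_ge0.
have H := xgetPex (0 : bop V U)
  (P := [set S : bop V U | forall x y, hdot (T x) y = hdot x (S y)]).
apply: H; exists (Bop (bop_pred_hnorm Sl SM)) => u v /=.
by rewrite hS.
Qed.

Lemma adjPr U V (T : bop U V) x y : hdot x (T y) = hdot (adj T x) y.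
Proof. by rewrite hdotC adjP -hdotC. Qed.

Lemma bopP U V (S T : bop U V) : (forall x, S x = T x) -> S = T.
Proof. by move=> h; apply/val_inj/funext. Qed.

Lemma adj_unique U V (T : bop U V) (S : bop V U) :
  (forall x y, hdot (T x) y = hdot x (S y)) -> adj T = S.
Proof. by move=> h; apply: bopP => y; apply: hdot_inj => x; rewrite -adjP. Qed.

Lemma adj_comp U V X (S : bop V X) (T : bop U V) : adj (S ∘ T) = adj T ∘ adj S.
Proof. by apply: adj_unique => x y; rewrite -[LHS]/(hdot (S (T x)) y) !adjP. Qed.

Lemma adjD U V (S T : bop U V) : adj (S + T) = adj S + adj T.
Proof.
apply: adj_unique => x y; rewrite -[(S + T) x]/(S x + T x).
by rewrite -[(adj S + adj T) y]/(adj S y + adj T y) hdotDl hdotDr !adjP.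
Qed.

Lemma adjZ U V (a : C) (T : bop U V) : adj (a *: T) = a^* *: adj T.
Proof.
apply: adj_unique => x y; rewrite -[(a *: T) x]/(a *: T x).
by rewrite -[(_ *: adj T) y]/(_ *: adj T y) hdotZl hdotZr conjCK adjP.
Qed.

Lemma adj0 U V : adj (0 : bop U V) = 0.
Proof.
apply: adj_unique => x y; rewrite -[(0 : bop U V) x]/(0 : V).
by rewrite -[(0 : bop V U) y]/(0 : U) hdot0l hdot0r.
Qed.

Lemma adjN U V (T : bop U V) : adj (- T) = - adj T.
Proof. by rewrite -scaleN1r adjZ rmorphN1 scaleN1r. Qed.

Lemma adjM E (S T : bop E E) : adj (S * T) = adj T * adj S.
Proof. exact: adj_comp. Qed.

Lemma adj1 E : adj (1 : bop E E) = 1.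
Proof. exact: adj_unique. Qed.

Lemma scale_bopAl E (a : C) (S T : bop E E) : (a *: S) * T = a *: (S * T).
Proof. exact: bopP. Qed.

Lemma scale_bopAr E (a : C) (S T : bop E E) : S * (a *: T) = a *: (S * T).
Proof. by apply: bopP => x; exact: linearZ. Qed.

Lemma bop_sumE U V (I : Type) (r : seq I) (P : pred I) (F : I -> bop U V) x :
  (\sum_(i <- r | P i) F i) x = \sum_(i <- r | P i) F i x.
Proof. by apply: (big_morph (fun T : bop U V => T x)). Qed.

(** The lower bound on [T] gives injectivity and the bound of the inverse. The one on [adj T] gives
    surjectivity: solving <T^* z, T^* x> = <z, y> for all z makes [adj T x] a preimage of [y]. *)
Lemma inv_bopP E (T : bop E E) (c : R) : 0 < c ->
  (forall x, hnorm x <= c * hnorm (T x)) ->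
  (forall x, hnorm x <= c * hnorm (adj T x)) ->
  inv_bop T * T = 1 /\ T * inv_bop T = 1.
Proof.
move=> c0 hT hT'.
have /choice[S hS] : forall y, exists x, T x = y.
  move=> y; have y1 : 0 < hnorm y + 1 by rewrite ltr_wpDl ?hnorm_ge0.
  have := @bounded_below_representation R E E (adj T) c
    (fun z => hdot z y) (hnorm y + 1) _ _ c0 hT' y1.
  case=> //.
  - by move=> u v; rewrite hdotDl.
  - by move=> a u; rewrite hdotZl.
  - move=> u; apply: le_trans (rdot_le _ _) _.
    by rewrite mulrC ler_wpM2r ?hnorm_ge0 // lerDl.
  - move=> x hx; exists (adj T x); apply: hdot_inj => z.
    by rewrite adjPr hx.
have Tinj x y : T x = T y -> x = y.
  move=> xy; apply/eqP; rewrite -subr_eq0; apply/eqP/hnorm_eq0/eqP.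
  rewrite eq_le hnorm_ge0 andbT; apply: le_trans (hT _) _.
  by rewrite bopB xy subrr hnorm0 mulr0.
have Sl : linear S by move=> a u v; apply: Tinj; rewrite bopD bopZ !hS.
have SM u : hnorm (S u) <= c * hnorm u by rewrite (le_trans (hT _)) ?hS.
have H := xgetPex (0 : bop E E) (P := [set S : bop E E | S * T = 1 /\ T * S = 1]).
apply: H; exists (Bop (bop_pred_hnorm Sl SM)); split; apply: bopP => x /=.
  exact: Tinj.
exact: hS.
Qed.

End Adjoint.

(** * The Siegel half-space and the Cayley transform *)

Lemma mul_add_sub_diff (A : pzRingType) (a b c d : A) :
  (a + b) * (c + d) - (a - b) * (c - d) = (a * d + b * c) *+ 2.
Proof.
have -> : (a + b) * (c + d) = (a * c + b * d) + (a * d + b * c).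
  by rewrite mulrDl !mulrDr [b * c + _]addrC addrACA.
have -> : (a - b) * (c - d) = (a * c + b * d) - (a * d + b * c).
  by rewrite mulrBl !mulrBr opprB opprD addrACA [_ - b * c]addrC addrACA.
by rewrite opprB addrC subrKA mulr2n.
Qed.

Lemma Re_imag_le (K : rcfType) (a b : K[i]) (m : K) :
  `|a| <= (m%:C)%C -> `|b| <= (m%:C)%C ->
  complex.Re ((2 * 'i)^-1 * (a - b)) <= m.
Proof.
move=> am bm; rewrite -lecR.
apply: (@le_trans _ _ `|(2 * 'i)^-1 * (a - b)|).
  by apply: le_trans (normc_ge_Re _); rewrite lecR ler_norm.
rewrite normrM normfV normrM normCi mulr1 normr_nat ler_pdivrMl //.
apply: le_trans (ler_normB _ _) _.
by rewrite mulr_natl mulr2n lerD.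
Qed.

Section SiegelDomain.
Variables (R : realType) (E : hilbertType R) (d : nat).
Local Notation C := R[i].
Implicit Types (W : 'I_d.+1 -> bop E E) (T K : bop E E).

Definition im_bop T : bop E E := (2 * 'i)^-1 *: (T - adj T).

(** With its counterpart for [adj T], this turns a lower bound on the imaginary part of [T] into
    lower bounds on both [T] and [adj T], as [inv_bopP] requires. *)
Lemma rdot_im_bop_le T x : rdot (im_bop T x) x <= hnorm (T x) * hnorm x.
Proof.
rewrite /rdot -[im_bop T x]/((2 * 'i)^-1 *: (T x - adj T x)) hdotZl hdotBl.
apply: Re_imag_le; rewrite rmorphM /= -!hnormE.
  exact: hdot_le.
by rewrite -adjPr mulrC; exact: hdot_le.
Qed.

Lemma rdot_im_bop_adj_le T x : rdot (im_bop T x) x <= hnorm (adj T x) * hnorm x.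
Proof.
rewrite /rdot -[im_bop T x]/((2 * 'i)^-1 *: (T x - adj T x)) hdotZl hdotBl.
apply: Re_imag_le; rewrite rmorphM /= -!hnormE.
  by rewrite adjP mulrC; exact: hdot_le.
exact: hdot_le.
Qed.

Lemma im_bop_shift T : im_bop ('i *: (1 : bop E E) + T) = 1 + im_bop T.
Proof.
rewrite /im_bop adjD adjZ adj1 conjCi opprD addrACA -scaleNr opprK -scalerDl.
rewrite scalerDr scalerA -mulr2n -(mulr_natl ('i : C)) mulVf ?scale1r //.
by rewrite mulf_neq0 ?pnatr_eq0 // neq0Ci.
Qed.

Lemma siegel_rdot W : siegel W -> exists2 e : R, 0 < e & forall x,
  e * hnorm x ^+ 2 + \sum_(k | k != ord_max) hnorm (adj (W k) x) ^+ 2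
    <= rdot (im_bop (W ord_max) x) x.
Proof.
case=> e [e0 he]; exists e => // x; have := he x.
set S := \sum_(k | _) _; rewrite -[X in hdot X _]/((e%:C)%C *: x).
rewrite -[X in _ <= hdot X _]/(im_bop (W ord_max) x - S x).
rewrite hdotZl hdotBl lecE => /andP[_].
rewrite ReM_real -/(rdot x x) rdotxx raddfB /= -/(rdot _ _) => h.
rewrite -lerBrDr; apply: le_trans h _; rewrite lerB //.
rewrite /S bop_sumE (big_morph (fun y => hdot y x) (id1 := 0) (op1 := +%R)).
- rewrite raddf_sum /=; apply: ler_sum => k _.
  by rewrite adjP -/(rdot _ _) rdotxx.
- by move=> u v; rewrite hdotDl.
- by rewrite hdot0l.
Qed.

(** The imaginary part of W_N is nonnegative, so that of i + W_N is at least 1, which bounds the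
    operator and its adjoint below with constant 1. *)
Lemma siegel_inv W : siegel W ->
  iW_inv W * ('i *: (1 : bop E E) + W ord_max) = 1 /\ ('i *: (1 : bop E E) + W ord_max) * iW_inv W = 1.
Proof.
move=> /siegel_rdot[e e0 he]; set T := 'i *: (1 : bop E E) + W ord_max.
have lb x : hnorm x ^+ 2 <= rdot (im_bop T x) x.
  rewrite im_bop_shift -[X in rdot X _]/(x + im_bop (W ord_max) x) rdotDl rdotxx.
  rewrite lerDl; apply: le_trans (he x); rewrite addr_ge0 ?sumr_ge0 //.
    by rewrite mulr_ge0 ?sqr_ge0 // ltW.
  by move=> k _; rewrite sqr_ge0.
have sq x (y : R) : 0 <= y -> hnorm x ^+ 2 <= y * hnorm x -> hnorm x <= 1 * y.
  rewrite mul1r expr2 => y0.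
  have [->//|n0] := eqVneq (hnorm x) 0.
  by rewrite ler_pM2r // lt_def n0; exact: hnorm_ge0.
apply: (@inv_bopP R E T 1) => // x; apply: sq (hnorm_ge0 _) _;
  apply: le_trans (lb x) _.
- exact: rdot_im_bop_le.
- exact: rdot_im_bop_adj_le.
Qed.

(** The terms K and T K T'^* cancel; the mixed terms add up to -2i times T K - K T'^*, and -2i = 4 /
    2i. *)
Lemma cayley_shift_diff T T' K :
  ('i *: (1 : bop E E) + T) * K * adj ('i *: (1 : bop E E) + T') - ('i *: (1 : bop E E) - T) * K * adj ('i *: (1 : bop E E) - T')
  = 4 *: ((2 * 'i)^-1 *: (T * K - K * adj T')).
Proof.
rewrite adjD adjD adjN adjZ adj1 conjCi mulrDl mulrBl mul_add_sub_diff.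
rewrite !scale_bopAl !scale_bopAr mul1r mulr1 scaleNr -scalerBr -opprB scalerN.
rewrite scalerA -scaleNr scalerMnl; congr (_ *: _).
rewrite invfM invCi mulrA -mulr_natl; congr (_ * _).
have n2 : (2 : C) != 0 by rewrite pnatr_eq0.
by apply: (mulIf n2); rewrite mulfVK // -natrM.
Qed.

(* With [V] the inverse of [i + W_N], [K = V (i + W_N) K (i + W'_N)^* V'^*]
   and the last term of the sum is [V (i - W_N) K (i - W'_N)^* V'^*]. *)
Lemma cayley_inv_diff W W' K : siegel W -> siegel W' ->
  K - \sum_k cayley_inv W k * K * adj (cayley_inv W' k) =
  4 *: (iW_inv W * ((2 * 'i)^-1 *: (W ord_max * K - K * adj (W' ord_max))
          - \sum_(k | k != ord_max) W k * K * adj (W' k)) * adj (iW_inv W')).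
Proof.
move=> /siegel_inv[VT _] /siegel_inv[VT' _].
rewrite (bigD1 ord_max) //= {1 2}/cayley_inv eqxx opprD addrA.
set A := (2 * 'i)^-1 *: _; rewrite (mulrBr _ A) mulrBl scalerBr /A.
congr (_ - _).
  rewrite -scale_bopAl -scale_bopAr -cayley_shift_diff.
  rewrite [in RHS]mulrBr [RHS]mulrBl.
  congr (_ - _).
    rewrite !mulrA VT mul1r -mulrA -adjM VT' adj1 mulr1 //.
  by rewrite adjM !mulrA.
rewrite mulr_sumr mulr_suml scaler_sumr; apply: eq_bigr => k /negPf kN.
rewrite /cayley_inv kN adjZ !scale_bopAl scale_bopAr scalerA adjM !mulrA.
congr (_ *: _); rewrite rmorphM rmorph_nat /= conjCi mulrACA mulrN -(expr2 'i) sqrCi.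
by rewrite opprK mulr1 -natrM.
Qed.

(** At K = 1 and W' = W the identity reads 1 - sum_k Z_k Z_k^* = 4 V (Im W_N - Q) V^*, which is at
    least 4 e V V^*. Moreover |V^* x| >= |x| / M when M bounds the adjoint of i + W_N, since V^* is
    inverse to it. *)
Lemma cayley_ball W : siegel W -> exists c : R, [/\ 0 < c, c < 1 &
  forall x, \sum_k hnorm (adj (cayley_inv W k) x) ^+ 2 <= c * hnorm x ^+ 2].
Proof.
move=> sW; have [e e0 he] := siegel_rdot sW; have [VT TV] := siegel_inv sW.
set V := iW_inv W; set T := _ + W ord_max in VT TV.
have [M M0 hM] := bop_hnorm (adj T).
(* The constant found is [1 - 4 * e / M ^+ 2]; the maximum with 1/2 keeps [c] positive, so that
   later estimates can cancel it. *)
pose c := Num.max (2^-1) (1 - 4 * e / M ^+ 2); exists c.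
have c12 : 2^-1 <= c by rewrite /c le_max lexx.
split.
- by apply: lt_le_trans c12; rewrite invr_gt0.
- rewrite /c gt_max; apply/andP; split; first by lra.
  by rewrite ltrBlDr ltrDl divr_gt0 ?mulr_gt0 ?exprn_gt0.
move=> x.
have xE : hnorm x <= M * hnorm (adj V x).
  by apply: le_trans (hM _); rewrite -[adj T _]/((adj T * adj V) x) -adjM VT adj1.
have x2 : hnorm x ^+ 2 / M ^+ 2 <= hnorm (adj V x) ^+ 2.
  by rewrite ler_pdivrMr ?exprn_gt0 // mulrC -exprMn lerXn2r ?nnegrE
    ?mulr_ge0 ?hnorm_ge0 // ltW.
have sumE (P : pred 'I_d.+1) (Z : 'I_d.+1 -> bop E E) y :
    rdot ((\sum_(k | P k) Z k * adj (Z k)) y) y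
    = \sum_(k | P k) hnorm (adj (Z k) y) ^+ 2.
  rewrite bop_sumE (big_morph (fun u => rdot u y) (id1 := 0) (op1 := +%R)).
  - apply: eq_bigr => k _; rewrite -[X in rdot X _]/(Z k (adj (Z k) y)).
    by rewrite /rdot adjP -/(rdot _ _) rdotxx.
  - by move=> u v; rewrite rdotDl.
  - by rewrite /rdot hdot0l.
set Q := \sum_(k | k != ord_max) W k * adj (W k).
have key : 1 - \sum_k cayley_inv W k * adj (cayley_inv W k)
    = 4 *: (V * (im_bop (W ord_max) - Q) * adj V).
  have := cayley_inv_diff 1 sW sW; rewrite (mulr1 (W ord_max)) mul1r.
  under eq_bigr do rewrite mulr1.
  by under [in RHS]eq_bigr do rewrite mulr1.
have := congr1 (fun B : bop E E => rdot (B x) x) key.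
rewrite -[X in rdot X _ = _]/(x - (\sum_k cayley_inv W k * adj (cayley_inv W k)) x) rdotDl rdotNl sumE rdotxx.
set B := im_bop _ - Q.
rewrite -[X in _ = rdot X _]/((4 : C) *: V (B (adj V x))).
have -> : (4 : C) = ((4 : R)%:C)%C by rewrite rmorph_nat.
rewrite rdotZl {1}/rdot adjP -/(rdot _ _).
rewrite -[B _]/(im_bop (W ord_max) (adj V x)
  - Q (adj V x)).
rewrite rdotDl rdotNl sumE => eq1.
have := he (adj V x); set s1 := \sum_(k | _) _ in eq1 *; move=> le1.
have cx : (1 - 4 * e / M ^+ 2) * hnorm x ^+ 2 <= c * hnorm x ^+ 2.
  by rewrite ler_wpM2r ?sqr_ge0 // /c le_max lexx orbT.
have ex : e * (hnorm x ^+ 2 / M ^+ 2) <= e * hnorm (adj V x) ^+ 2.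
  by rewrite ler_wpM2l // ltW.
have eE : 4 * e / M ^+ 2 * hnorm x ^+ 2 = 4 * (e * (hnorm x ^+ 2 / M ^+ 2)).
  by ring.
by rewrite mulrBl eE in cx; lra.
Qed.

End SiegelDomain.

(** * Convergence of the row operator of a strict row contraction *)

Lemma big_tupleS (A : finType) (V : nmodType) n (F : seq A -> V) :
  \sum_(t : n.+1.-tuple A) F t = \sum_i \sum_(t : n.-tuple A) F (i :: t).
Proof.
rewrite pair_big /= (reindex (fun q : A * n.-tuple A => cons_tuple q.1 q.2)) //=.
exists (fun t : n.+1.-tuple A => (thead t, [tuple of behead t])) => [[i t] _|t _].
  by congr (_, _); apply/val_inj.
by rewrite [RHS]tuple_eta; apply/val_inj.
Qed.

Lemma big_tuple0 (A : finType) (V : nmodType) (F : seq A -> V) :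
  \sum_(t : 0.-tuple A) F t = F [::].
Proof. by rewrite (big_pred1 [tuple]) // => t; apply/esym/eqP/val_inj; case: t => -[]. Qed.

Section RowContraction.
Variables (R : realType) (E : hilbertType R) (A : finType).
Variables (Z : A -> bop E E) (c : R).
Hypothesis (c0 : 0 < c).
Hypothesis Zc : forall x, \sum_k hnorm (adj (Z k) x) ^+ 2 <= c * hnorm x ^+ 2.
Local Notation C := R[i].

(** The hypothesis bounds the column of adjoints. To pass to the row, put g = sum_k Z_k x_k and
    expand the nonnegative sum of |c x_k - Z_k^* g|^2: it is at most c^2 sum_k |x_k|^2 - c |g|^2. *)
Lemma row_contraction (x : A -> E) :
  hnorm (\sum_k Z k (x k)) ^+ 2 <= c * \sum_k hnorm (x k) ^+ 2.
Proof.
set g := \sum_k _; set S := \sum_k _.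
have : 0 <= \sum_k hnorm ((c%:C)%C *: x k - adj (Z k) g) ^+ 2.
  by apply: sumr_ge0 => k _; exact: sqr_ge0.
have -> : \sum_k hnorm ((c%:C)%C *: x k - adj (Z k) g) ^+ 2 =
    c ^+ 2 * S - 2 * c * \sum_k rdot (Z k (x k)) g
      + \sum_k hnorm (adj (Z k) g) ^+ 2.
  rewrite !mulr_sumr -sumrB -big_split; apply: eq_bigr => k _ /=.
  rewrite -!rdotxx !(rdotDl, rdotNl) !rdotDr !rdotNr !rdotZl !rdotZr.
  by rewrite (rdotC (adj _ _) (x k)) {2 3}/rdot -adjP -/(rdot _ _); ring.
have -> : \sum_k rdot (Z k (x k)) g = hnorm g ^+ 2.
  rewrite -rdotxx {2}/g (big_morph (fun u => rdot u g) (id1 := 0) (op1 := +%R)) //.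
    by move=> u v; rewrite rdotDl.
  by rewrite /rdot hdot0l.
have := Zc g => h1 h2; rewrite -(ler_pM2l c0); lra.
Qed.

Lemma level_contraction n (f : seq A -> E) :
  hnorm (\sum_(t : n.-tuple A) word_op Z t (f t)) ^+ 2
    <= c ^+ n * \sum_(t : n.-tuple A) hnorm (f t) ^+ 2.
Proof.
elim: n f => [|n IH] f.
  rewrite (big_tuple0 (fun s => word_op Z s (f s))).
  rewrite (big_tuple0 (fun s => hnorm (f s) ^+ 2)).
  by rewrite expr0 mul1r /word_op big_nil.
have -> : \sum_(t : n.+1.-tuple A) hnorm (f t) ^+ 2
    = \sum_i \sum_(t : n.-tuple A) hnorm (f (i :: t)) ^+ 2.
  exact: (big_tupleS n (fun s => hnorm (f s) ^+ 2)).
have -> : \sum_(t : n.+1.-tuple A) word_op Z t (f t)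
    = \sum_i Z i (\sum_(t : n.-tuple A) word_op Z t (f (i :: t))).
  rewrite (big_tupleS n (fun s => word_op Z s (f s))).
  apply: eq_bigr => i _; rewrite linear_sum; apply: eq_bigr => t _.
  by rewrite /word_op big_cons.
apply: le_trans (row_contraction _) _.
rewrite exprS -mulrA ler_pM2l // mulr_sumr; apply: ler_sum => i _.
exact: (IH (fun s => f (i :: s))).
Qed.

Lemma level_le_hnorm n (f : hsum A E) :
  \sum_(t : n.-tuple A) hnorm (f t) ^+ 2 <= hnorm f ^+ 2.
Proof.
have : level_sum n.+1 (fun s => hdot (f s) (f s)) <= hdot f f := hsum_dot_ge f n.+1.
rewrite hdot_hnorm (eq_level_sum _ (G := fun s => ((hnorm (f s) ^+ 2)%:C)%C)); last first.
  by move=> s; rewrite hdot_hnorm.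
rewrite (level_sum_morph (h := real_complex R)) ?lecR //; last exact: rmorphD.
apply: le_trans; rewrite /level_sum big_ord_recr /= lerDr.
by apply: sumr_ge0 => k _; apply: sumr_ge0 => t _; exact: sqr_ge0.
Qed.

Hypothesis c1 : c < 1.

Let u (f : seq A -> E) n := level_sum n (fun s => word_op Z s (f s)).
Let q := Num.sqrt c.

Let q0 : 0 < q. Proof. by rewrite sqrtr_gt0. Qed.
Let q1 : q < 1.
Proof. by rewrite -sqrtr1 ltr_sqrt. Qed.
Let q2 : q ^+ 2 = c. Proof. by rewrite sqr_sqrtr // ltW. Qed.

(** Level j contributes at most q^j |f|. The geometric sum is kept in closed form, which makes the
    inductive step an equality of bounds. *)
Lemma level_sum_dist (f : hsum A E) m k :
  hnorm (u f (m + k) - u f m) <= (q ^+ m - q ^+ (m + k)) * (hnorm f / (1 - q)).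
Proof.
elim: k => [|k IH]; first by rewrite addn0 !subrr hnorm0 mul0r.
rewrite addnS; set g := \sum_(t : (m + k).-tuple A) word_op Z t (f t).
have -> : u f (m + k).+1 - u f m = (u f (m + k) - u f m) + g.
  by rewrite /u {1}/level_sum big_ord_recr /= addrAC.
have gle : hnorm g <= q ^+ (m + k) * hnorm f.
  rewrite -ler_sqr ?nnegrE ?mulr_ge0 ?hnorm_ge0 ?exprn_ge0 ?(ltW q0) //.
  apply: le_trans (level_contraction _ _) _.
  by rewrite exprMn -exprM mulnC exprM q2 ler_wpM2l ?level_le_hnorm // exprn_ge0 // ltW.
apply: le_trans (hnormD _ _) _; apply: le_trans (lerD IH gle) _.
rewrite exprS; set a := q ^+ (m + k).
have n1 : 1 - q != 0 by rewrite subr_eq0 gt_eqF.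
by rewrite le_eqVlt; apply/orP; left; apply/eqP; field.
Qed.

Lemma level_sum_cvgn (f : hsum A E) : exists l : E, u f @ \oo --> l.
Proof.
set K := hnorm f / (1 - q).
have K0 : 0 <= K by rewrite divr_ge0 ?hnorm_ge0 // subr_ge0 ltW.
(* In the square of q^m - q^(m + k) the cross term is negative, which leaves c^m + c^(m + k). *)
apply: (@hilbert_cvg R E _ (fun n => K ^+ 2 * c ^+ n)).
  rewrite -(mulr0 (K ^+ 2)); apply: cvgMr; apply: cvg_expr.
  by rewrite ger0_norm // ltW.
move=> m n; wlog mn : m n / (m <= n)%N.
  move=> h; case: (leqP m n) => [|/ltnW] mn; first exact: h.
  by rewrite hnormB [leRHS]addrC; exact: h.
rewrite hnormB -(subnKC mn); set k := (n - m)%N.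
apply: (@le_trans _ _ (((q ^+ m - q ^+ (m + k)) * K) ^+ 2)).
  rewrite lerXn2r ?nnegrE ?hnorm_ge0 ?level_sum_dist //.
  exact: le_trans (hnorm_ge0 _) (level_sum_dist _ _ _).
rewrite -q2 -!exprM !(mulnC 2) !exprM exprMn mulrC -mulrDr ler_wpM2l ?sqr_ge0 //.
have : 0 <= q ^+ m * q ^+ (m + k) by rewrite mulr_ge0 ?exprn_ge0 // ltW.
nra.
Qed.

Lemma level_sum_bounded (f : hsum A E) n : hnorm (u f n) <= (1 - q)^-1 * hnorm f.
Proof.
have := level_sum_dist f 0 n; rewrite add0n {2}/u /level_sum big_ord0 subr0.
move/le_trans; apply; rewrite expr0 mulrC [leRHS]mulrC -[leRHS]mulr1.
rewrite ler_wpM2l ?divr_ge0 ?hnorm_ge0 ?subr_ge0 ?(ltW q1) //.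
by rewrite lerBlDr lerDl exprn_ge0 // ltW.
Qed.

(** The pointwise limit of the partial sums inherits linearity and the uniform bound 1 / (1 - q), so
    it is a witness for the choice in [row_op]. *)
Lemma row_opP (f : hsum A E) :
  (fun n => level_sum n (fun s => word_op Z s (f s))) @ \oo --> row_op Z f.
Proof.
have /choice[T hT] := level_sum_cvgn.
have Tl : linear T.
  move=> a g h; have := hT (a *: g + h).
  have -> : u (a *: g + h) = (fun n => a *: u g n + u h n).
    apply/funext => n; rewrite /u -(level_sum_morph (h := *:%R a)) ?scaler0 //.
      rewrite -level_sumD; apply: eq_level_sum => s.
      by rewrite -[(a *: g + h : hsum A E) s]/(a *: g s + h s) bopD bopZ.
    exact: scalerDr.
  move=> h1; have h2 : (fun n => a *: u g n + u h n) @ \oo --> a *: T g + T h.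
    by apply: cvgD; [apply: cvgZr|].
  by apply: cvg_unique h1 h2; exact: norm_hausdorff.
have TM g : hnorm (T g) <= (1 - q)^-1 * hnorm g.
  have : (fun n => hnorm (T g - u g n) + (1 - q)^-1 * hnorm g) @ \oo
      --> 0 + (1 - q)^-1 * hnorm g.
    by apply: cvgD; [apply/cvg_hnorm | exact: cvg_cst].
  rewrite add0r => h; apply: (cvgr_to_ge h); apply: nearW => n.
  apply: le_trans (lerD (lexx _) (level_sum_bounded g n)).
  by apply: le_trans (hnormD _ _); rewrite subrK.
have H := xgetPex (0 : bop (hsum A E) E)
  (P := [set T : bop (hsum A E) E | forall f : hsum A E,
    (fun n => level_sum n (fun s => word_op Z s (f s))) @ \oo --> T f]).
by apply: H; exists (Bop (bop_pred_hnorm Tl TM)) => g; exact: hT.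
Qed.

End RowContraction.

(** * Coordinate vectors and diagonal operators on the direct sum *)

Section DeltaSum.
Variables (R : realType) (E : hilbertType R) (A : finType).
Local Notation C := R[i].

Lemma level_sum_recr (V : nmodType) n (F : seq A -> V) :
  level_sum n.+1 F = level_sum n F + \sum_(t : n.-tuple A) F t.
Proof. by rewrite /level_sum big_ord_recr. Qed.

Lemma level_sum_delta (V : nmodType) (F : seq A -> V) s n :
  (forall t, t != s -> F t = 0) -> (size s < n)%N -> level_sum n F = F s.
Proof.
move=> Fs sn; rewrite /level_sum (bigD1 (Ordinal sn)) //=.
rewrite (bigD1 (in_tuple s)) //= !big1 ?addr0 // => [k kn|t ts].
  rewrite big1 // => t _; apply: Fs; apply: contraNneq kn => ts.
  by apply/eqP/val_inj; rewrite /= -ts size_tuple.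
by apply: Fs; apply: contraNneq ts => ts; apply/eqP/val_inj.
Qed.

Lemma hsum_delta_subproof (s : seq A) (v : E) :
  (fun t => if t == s then v else 0) \in @hsum_pred R A E.
Proof.
apply/asboolP; exists (`|v| ^+ 2) => n; set F := fun t => _.
have F0 t : 0 <= F t by exact: exprn_ge0.
(* Enlarging the range to reach the level of [s] makes the sum exactly [|v| ^+ 2]. *)
apply: (@le_trans _ _ (level_sum (maxn n (size s).+1) F)).
  rewrite /level_sum -!(big_mkord xpredT (fun k => \sum_(t : k.-tuple A) F t)).
  rewrite [leRHS](big_cat_nat (n := n)) ?leq_maxl //= lerDl.
  by apply: sumr_ge0 => k _; apply: sumr_ge0.
rewrite (@level_sum_delta _ F s) ?leq_maxr //; first by rewrite /F eqxx.
by move=> t /negPf ts; rewrite /F ts normr0 expr0n.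
Qed.

(** Pairing with these vectors reads off coordinates, so adjoints on the direct sum can be computed
    word by word. *)
Definition hsum_delta s v : hsum A E := Hsum (hsum_delta_subproof s v).

Lemma hdot_delta s v (f : hsum A E) : hdot (hsum_delta s v) f = hdot v (f s).
Proof.
apply: hsum_dot_lim; apply: (@cvg_near_cst _ R[i]^o).
exists (size s).+1 => // n /= sn.
rewrite (@level_sum_delta _ _ s) //= ?eqxx // => t /negPf ->.
by rewrite hdot0l.
Qed.

Lemma diag_opM (S T : bop E E) :
  diag_op A (S * T) = diag_op A S ∘ diag_op A T.
Proof. by apply: bopP => f; apply/val_inj. Qed.

Lemma diag_opZ a (T : bop E E) : diag_op A (a *: T) = a *: diag_op A T.
Proof. by apply: bopP => f; apply/val_inj. Qed.

Lemma diag_opD (S T : bop E E) : diag_op A (S + T) = diag_op A S + diag_op A T.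
Proof. by apply: bopP => f; apply/val_inj. Qed.

Lemma diag_opB (S T : bop E E) : diag_op A (S - T) = diag_op A S - diag_op A T.
Proof. by apply: bopP => f; apply/val_inj. Qed.

Lemma diag_op0 : diag_op A (0 : bop E E) = 0.
Proof. by apply: bopP => f; apply/val_inj. Qed.

Lemma diag_op_sum (I : Type) (r : seq I) (P : pred I) (F : I -> bop E E) :
  diag_op A (\sum_(i <- r | P i) F i) = \sum_(i <- r | P i) diag_op A (F i).
Proof. by apply: (big_morph (@diag_op R E A)); [exact: diag_opD | exact: diag_op0]. Qed.

Lemma adj_diag_op (T : bop E E) : adj (diag_op A T) = diag_op A (adj T).
Proof.
apply: bopP => f; apply/val_inj/funext => s; apply: hdot_inj => v /=.
rewrite -hdot_delta -[LHS]adjP -[RHS]adjP.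
have -> : diag_op A T (hsum_delta s v) = hsum_delta s (T v).
  by apply/val_inj/funext => t /=; case: eqP => // _; exact: linear0.
by rewrite hdot_delta.
Qed.

End DeltaSum.

(** * Telescoping of row, diagonal and column *)

Section RowOperator.
Variables (R : realType) (E : hilbertType R) (A : finType).
Local Notation C := R[i].

Definition strict_row_contraction (Z : A -> bop E E) : Prop :=
  exists c : R, [/\ 0 < c, c < 1 &
    forall x, \sum_k hnorm (adj (Z k) x) ^+ 2 <= c * hnorm x ^+ 2].

Variables (Z Z' : A -> bop E E).
Hypotheses (hZ : strict_row_contraction Z) (hZ' : strict_row_contraction Z').

(** On a vector supported at [s] the row series is constant past level [size s], with value
    [word_op Z' s v]. *)
Lemma adj_row_op x s : adj (row_op Z') x s = adj (word_op Z' s) x.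
Proof.
apply: hdot_inj => v; rewrite -hdot_delta -[LHS]adjP -[RHS]adjP; congr (hdot _ x).
have [c [c0 c1 hc]] := hZ'; have h := row_opP c0 hc c1 (f := hsum_delta s v).
apply: (cvg_unique _ h); first exact: norm_hausdorff.
apply: cvg_near_cst; exists (size s).+1 => // n /= sn.
rewrite (@level_sum_delta _ _ _ s) //= ?eqxx // => t /negPf ->.
exact: linear0.
Qed.

Definition row_conj (K : bop E E) : bop E E := \sum_k Z k * K * adj (Z' k).

Lemma iter_row_conj n K :
  iter n row_conj K = \sum_(t : n.-tuple A) word_op Z t * K * adj (word_op Z' t).
Proof.
elim: n => [|n IH] /=.
  rewrite (big_tuple0 (fun s => word_op Z s * K * adj (word_op Z' s))).
  by rewrite /word_op !big_nil adj1 mulr1 mul1r.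
rewrite (big_tupleS n (fun s => word_op Z s * K * adj (word_op Z' s))) IH.
apply: eq_bigr => k _; rewrite mulr_sumr mulr_suml; apply: eq_bigr => t _.
by rewrite /word_op !big_cons adjM !mulrA.
Qed.

Lemma level_sum_row_conj n K :
  level_sum n (fun s => word_op Z s * (K - row_conj K) * adj (word_op Z' s))
  = K - iter n row_conj K.
Proof.
elim: n => [|n IH]; first by rewrite subrr /level_sum big_ord0.
rewrite level_sum_recr IH /=.
(* The extra conjugation is moved innermost, so that both iterates become sums over words of the
   same length [n]. *)
rewrite -[row_conj (iter _ _ _)]/(iter n.+1 row_conj K) iterSr !iter_row_conj.
rewrite -[RHS](subrKA (iter n row_conj K)) iter_row_conj; congr (_ + _).
by rewrite -sumrB; apply: eq_bigr => t _; rewrite mulrBr mulrBl.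
Qed.

(* The row sum telescopes to [K - sum_(|s| = n) Z_s K Z'_s^*], whose last term
   tends strongly to [0]. *)
Lemma row_diag_adj_row K :
  row_op Z ∘ diag_op A (K - row_conj K) ∘ adj (row_op Z') = K.
Proof.
apply: bopP => x; have [c [c0 c1 hc]] := hZ.
set y := adj (row_op Z') x.
rewrite -[LHS]/(row_op Z (diag_op A (K - row_conj K) y)).
have h := row_opP c0 hc c1 (f := diag_op A (K - row_conj K) y).
apply: (cvg_unique _ h); first exact: norm_hausdorff.
have uE n : level_sum n (fun s => word_op Z s (diag_op A (K - row_conj K) y s))
    = K x - iter n row_conj K x.
  rewrite -[RHS]/((K - iter n row_conj K) x) -level_sum_row_conj.
  rewrite -(level_sum_morph (h := fun T : bop E E => T x)) //.
  by apply: eq_level_sum => s; rewrite /= adj_row_op.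
rewrite (_ : (fun n => _) = fun n => K x - iter n row_conj K x); last first.
  by apply/funext => n; exact: uE.
rewrite /= -[X in _ --> X]subr0; apply: cvgB; first exact: cvg_cst.
apply/cvg_hnorm; under eq_fun do rewrite sub0r hnormN.
pose M := hnorm (diag_op A K y).
apply: (@squeeze_cvgr _ _ _ _ (fun=> 0) (fun n => Num.sqrt c ^+ n * M)).
- apply: nearW => n; rewrite hnorm_ge0 /=.
  rewrite -ler_sqr ?nnegrE ?hnorm_ge0 ?mulr_ge0 ?exprn_ge0 ?hnorm_ge0 ?sqrtr_ge0 //.
  (* The remainder is level [n] of the row applied to the fixed square-summable vector
     [diag_op A K y], hence at most c^(n/2) times its norm. *)
  have -> : iter n row_conj K x
      = \sum_(t : n.-tuple A) word_op Z t (diag_op A K y t).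
    rewrite iter_row_conj bop_sumE; apply: eq_bigr => t _ /=.
    by rewrite adj_row_op.
  apply: le_trans (level_contraction c0 hc n _) _.
  rewrite exprMn -exprM mulnC exprM sqr_sqrtr ?(ltW c0) //.
  by rewrite ler_wpM2l ?level_le_hnorm // exprn_ge0 // ltW.
- exact: cvg_cst.
- rewrite -(mul0r M); apply: cvgMl; apply: cvg_expr.
  by rewrite ger0_norm ?sqrtr_ge0 // -sqrtr1 ltr_sqrt.
Qed.

End RowOperator.

(** * The operator F *)

Section Fop.
Variables (R : realType) (E : hilbertType R) (d : nat).
Variables W W' : 'I_d.+1 -> bop E E.
Hypotheses (hW : siegel W) (hW' : siegel W').

Lemma Fop_diag_adj T :
  Fop W ∘ diag_op 'I_d.+1 T ∘ adj (Fop W') =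
  row_op (cayley_inv W) ∘ diag_op 'I_d.+1 (4 *: (iW_inv W * T * adj (iW_inv W')))
    ∘ adj (row_op (cayley_inv W')).
Proof.
rewrite /Fop adjZ adj_comp adj_diag_op diag_opZ !diag_opM.
apply: bopP => x; set r := row_op _; set r' := adj (row_op _).
set v := diag_op _ (iW_inv W); set v' := diag_op _ (adj _).
rewrite -[LHS]/(2 *: r (v (diag_op _ T (2^* *: v' (r' x))))).
rewrite -[RHS]/(r (4 *: v (diag_op _ T (v' (r' x))))).
by rewrite rmorph_nat !bopZ scalerA -natrM.
Qed.

Lemma Fop_kernel_identity K :
  Fop W ∘ diag_op 'I_d.+1
      ((2 * 'i)^-1 *: (W ord_max * K - K * adj (W' ord_max))
        - \sum_(k | k != ord_max) W k * K * adj (W' k))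
    ∘ adj (Fop W') = K.
Proof.
rewrite Fop_diag_adj -cayley_inv_diff //.
by apply: row_diag_adj_row; exact: cayley_ball.
Qed.

End Fop.

(** * The free algebra: involution, degree and evaluation *)

Section FreeAlgebra.
Variables (R : realType) (d : nat).
Local Notation C := R[i].
Local Notation word := (seq 'I_d.+1).
Implicit Types (P Q : ncpoly R d) (s t : word).

Definition ncmon (s : word) (c : C) : ncpoly R d := mkmalgU (FMonom s) c.

Lemma mcoeff_ncmon s t c : mcoeff (FMonom t) (ncmon s c) = c *+ (s == t).
Proof. by rewrite mcoeffU. Qed.

Lemma ncmonZ s a c : a *: ncmon s c = ncmon s (a * c).
Proof.
apply/malgP => k; rewrite mcoeffZ !mcoeffU.
by case: (_ == _); rewrite ?mulr1n // !mulr0n mulr0.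
Qed.

Lemma ncmonM s t a b : ncmon s a * ncmon t b = ncmon (s ++ t) (a * b).
Proof.
rewrite malgM_def fgmulUU /ncmon; congr mkmalgU.
by apply/val_inj; rewrite [LHS]fmM.
Qed.

Lemma YmonE s : Ymon R s = ncmon s 1. Proof. by []. Qed.

Lemma ncpoly_ind (H : ncpoly R d -> Prop) : H 0 ->
  (forall P Q, H P -> H Q -> H (P + Q)) -> (forall s c, H (ncmon s c)) ->
  forall P, H P.
Proof.
move=> H0 HD HU P; rewrite (monalgE P); apply: big_ind => // k _.
by case: k => s; exact: HU.
Qed.

(** Monomials carry their coefficient and only additivity is assumed, so this applies to the
    conjugate-linear involution as well. *)
Lemma ncpoly_additive_ext (V : zmodType) (f g : ncpoly R d -> V) :
  {morph f : P Q / P + Q} -> {morph g : P Q / P + Q} ->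
  (forall s c, f (ncmon s c) = g (ncmon s c)) -> f =1 g.
Proof.
move=> fD gD fg; elim/ncpoly_ind => [|P Q HP HQ|s c]; last exact: fg.
  have h0 (h : ncpoly R d -> V) : {morph h : P Q / P + Q} -> h 0 = 0.
    by move=> hD; apply: (addrI (h 0)); rewrite -hD !addr0.
  by rewrite !h0.
by rewrite fD gD HP HQ.
Qed.

Section MonomialSum.
Variables (V : zmodType) (g : C -> fmonom 'I_d.+1 -> V).
Hypothesis gD : forall m, {morph g^~ m : a b / a + b}.

(** The common form of [ncinv] and [nceval]. Additivity is shown once, by extending the sums for P,
    Q and P + Q to a common finite support. *)
Definition monsum P : V := \sum_(m <- msupp P) g (mcoeff m P) m.

Let g0 m : g 0 m = 0.
Proof. by apply: (addrI (g 0 m)); rewrite -gD !addr0. Qed.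

Lemma monsum_wide (D : finmap.finSet (fmonom 'I_d.+1)) P :
  finmap.fsubset (msupp P) D -> monsum P = \sum_(m <- D) g (mcoeff m P) m.
Proof.
by move=> le; rewrite /monsum (finmap.big_fset_incl _ le) // => m _ /mcoeff_outdom ->.
Qed.

Lemma monsumD P Q : monsum (P + Q) = monsum P + monsum Q.
Proof.
pose D := finmap.fsetU (msupp P) (msupp Q).
rewrite !(@monsum_wide D) ?finmap.fsubsetUl ?finmap.fsubsetUr ?msuppD_le //.
by rewrite -big_split; apply: eq_bigr => m _; rewrite mcoeffD gD.
Qed.

Lemma monsum0 : monsum 0 = 0.
Proof. by rewrite /monsum big1 // => m _; rewrite mcoeff0. Qed.

Lemma monsum_ncmon s c : monsum (ncmon s c) = g c (FMonom s).
Proof.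
rewrite (monsum_wide (D := finmap.fset1 (FMonom s))) ?msuppU_le //.
by rewrite finmap.big_seq_fset1 mcoeffUU.
Qed.

End MonomialSum.

Lemma ncinvE P : ncinv P = monsum (fun c m => c^* *: Ymon R (rev (fmonom_val m))) P.
Proof. by []. Qed.

Lemma ncinv_morph m : {morph (fun c : C => c^* *: Ymon R (rev (fmonom_val m : word)))
  : a b / a + b}.
Proof. by move=> a b; rewrite rmorphD scalerDl. Qed.

Lemma ncinvD P Q : ncinv (P + Q) = ncinv P + ncinv Q.
Proof. by rewrite !ncinvE monsumD //; exact: ncinv_morph. Qed.

Lemma ncinv_ncmon s c : ncinv (ncmon s c) = ncmon (rev s) c^*.
Proof.
rewrite ncinvE monsum_ncmon; last exact: ncinv_morph.
by rewrite YmonE ncmonZ mulr1.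
Qed.

Lemma ncinvZ a P : ncinv (a *: P) = a^* *: ncinv P.
Proof.
apply: (ncpoly_additive_ext (f := fun P => ncinv (a *: P))
  (g := fun P => a^* *: ncinv P)) => [{}P Q|{}P Q|s c].
- by rewrite (scalerDr a P Q); exact: ncinvD.
- by rewrite (ncinvD P Q); exact: scalerDr.
- rewrite (ncmonZ s a c) !ncinv_ncmon rmorphM; exact/esym/ncmonZ.
Qed.

Lemma ncinv_YmonM i P : ncinv (Ymon R [:: i] * P) = ncinv P * Ymon R [:: i].
Proof.
apply: (ncpoly_additive_ext (f := fun P => ncinv (Ymon R [:: i] * P))
  (g := fun P => ncinv P * Ymon R [:: i])) => [{}P Q|{}P Q|s c].
- by rewrite (mulrDr _ P Q); exact: ncinvD.
- by rewrite (ncinvD P Q); exact: mulrDl.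
- by rewrite !YmonE ncmonM !ncinv_ncmon ncmonM mul1r mulr1 rev_cons cats1.
Qed.

Lemma ncpoly_scalerAr a P Q : P * (a *: Q) = a *: (P * Q).
Proof.
apply: (ncpoly_additive_ext (f := fun P => P * (a *: Q))
  (g := fun P => a *: (P * Q))) => [{}P P'|{}P P'|s c].
- exact: mulrDl.
- by rewrite (mulrDl P P' Q); exact: scalerDr.
apply: (ncpoly_additive_ext (f := fun Q => ncmon s c * (a *: Q))
  (g := fun Q => a *: (ncmon s c * Q))) => [{}Q Q'|{}Q Q'|t b].
- by rewrite (scalerDr a Q Q'); exact: mulrDr.
- by rewrite (mulrDr _ Q Q'); exact: scalerDr.
- by rewrite (ncmonZ t a b) !ncmonM mulrCA; exact/esym/ncmonZ.
Qed.

Definition degree_le (n : nat) P :=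
  forall s, mcoeff (FMonom s) P != 0 -> (size s <= n)%N.

Lemma degree_le_YmonM i n P : degree_le n P -> degree_le n.+1 (Ymon R [:: i] * P).
Proof.
move=> hP s; apply: contraNT; rewrite -ltnNge => ns.
rewrite (monalgE P) mulr_sumr raddf_sum big_seq big1 //= => -[t] tP.
rewrite YmonE -/(ncmon t _) ncmonM mcoeff_ncmon.
case: eqP => // ts; move: ns; rewrite -ts /= ltnS ltnNge.
by rewrite hP // mcoeff_neq0.
Qed.

Section Evaluation.
Variables (E : hilbertType R) (W : 'I_d.+1 -> bop E E).

Lemma ncevalE P : nceval P W = monsum (fun c m => c *: word_op W (fmonom_val m)) P.
Proof. by []. Qed.

Lemma nceval_morph m : {morph (fun c : C => c *: word_op W (fmonom_val m : word))
  : a b / a + b}.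
Proof. by move=> a b; rewrite scalerDl. Qed.

Lemma ncevalD P Q : nceval (P + Q) W = nceval P W + nceval Q W.
Proof. by rewrite !ncevalE monsumD //; exact: nceval_morph. Qed.

Lemma nceval0 : nceval (0 : ncpoly R d) W = 0.
Proof. by rewrite ncevalE monsum0 //; exact: nceval_morph. Qed.

Lemma nceval_ncmon s c : nceval (ncmon s c) W = c *: word_op W s.
Proof. by rewrite ncevalE monsum_ncmon //; exact: nceval_morph. Qed.

Lemma ncevalZ a P : nceval (a *: P) W = a *: nceval P W.
Proof.
apply: (ncpoly_additive_ext (f := fun P => nceval (a *: P) W)
  (g := fun P => a *: nceval P W)) => [{}P Q|{}P Q|s c].
- by rewrite (scalerDr a P Q); exact: ncevalD.
- by rewrite (ncevalD P Q); exact: scalerDr.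
- by rewrite (ncmonZ s a c) !nceval_ncmon scalerA.
Qed.

Lemma nceval_YmonM i P : nceval (Ymon R [:: i] * P) W = W i * nceval P W.
Proof.
apply: (ncpoly_additive_ext (f := fun P => nceval (Ymon R [:: i] * P) W)
  (g := fun P => W i * nceval P W)) => [{}P Q|{}P Q|s c].
- by rewrite (mulrDr _ P Q); exact: ncevalD.
- by rewrite (ncevalD P Q); exact: mulrDr.
- by rewrite YmonE ncmonM !nceval_ncmon mul1r /word_op big_cons scale_bopAr.
Qed.

End Evaluation.

End FreeAlgebra.

(** * Finite linear algebra over words of bounded length *)

Lemma fin_left_inverse (K : comNzRingType) (T : finType) (a b : T -> T -> K) :
  (forall s t, \sum_u a s u * b u t = (s == t)%:R) ->
  forall s t, \sum_u b s u * a u t = (s == t)%:R.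
Proof.
pose mx (f : T -> T -> K) := \matrix_(i < #|T|, j < #|T|) f (enum_val i) (enum_val j).
have mxM f g i j : (mx f *m mx g) i j = \sum_u f (enum_val i) u * g u (enum_val j).
  rewrite mxE [RHS](reindex (@enum_val T predT)) /=.
    by apply: eq_bigr => k _; rewrite !mxE.
  by exists enum_rank => x _; [exact: enum_valK | exact: enum_rankK].
move=> ab s t.
have ab1 : mx a *m mx b = 1%:M.
  by apply/matrixP => i j; rewrite mxM ab mxE (inj_eq enum_val_inj).
have := mxM b a (enum_rank s) (enum_rank t).
by rewrite (mulmx1C ab1) mxE !enum_rankK (inj_eq enum_rank_inj) => <-.
Qed.

(* [f (P + Q) (P + Q)] and [f (P + 'i Q) (P + 'i Q)] are real. *)
Lemma sesquilinear_real_herm (C : numClosedFieldType) (M : lmodType C) (f : M -> M -> C) :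
  (forall P P' Q, f (P + P') Q = f P Q + f P' Q) ->
  (forall P Q Q', f P (Q + Q') = f P Q + f P Q') ->
  (forall a P Q, f (a *: P) Q = a * f P Q) ->
  (forall a P Q, f P (a *: Q) = a^* * f P Q) ->
  (forall P, (f P P)^* = f P P) -> forall P Q, f P Q = (f Q P)^*.
Proof.
move=> fDl fDr fZl fZr freal P Q; set u := f P Q; set v := f Q P.
have e1 : u^* + v^* = u + v.
  have := freal (P + Q).
  rewrite fDl !fDr -/u -/v !rmorphD /= !freal => h.
  have {}h := congr1 (fun z => z - f P P - f Q Q) h.
  by transitivity (f P P + u^* + (v^* + f Q Q) - f P P - f Q Q);
    [|rewrite h]; ring.
have e2 : v - u = u^* - v^*.
  have := freal (P + 'i *: Q).
  rewrite fDl !fDr !fZl !fZr -/u -/v !rmorphD /= !rmorphM /= !conjCK !freal.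
  rewrite conjCi => h; apply: (mulfI (neq0Ci C)).
  have {}h := congr1 (fun z => z - f P P - 'i * (- 'i * f Q Q)) h.
  transitivity (f P P + - 'i * u + ('i * v + 'i * (- 'i * f Q Q))
    - f P P - 'i * (- 'i * f Q Q)); first by ring.
  by rewrite -h; ring.
have n2 : (2 : C) != 0 by rewrite pnatr_eq0.
apply: (mulfI n2); transitivity ((u + v) - (v - u)); first by ring.
by rewrite e2 -e1; ring.
Qed.

Section WordsUpTo.
Variables (A : finType) (n : nat).

(** A single finite index type for the double sum [level_sum], which makes matrix inversion and
    exchange of summation available. *)
Definition words_lt := {k : 'I_n & k.-tuple A}.

Definition word_lt (u : words_lt) : seq A := tagged u.

Lemma size_word_lt u : (size (word_lt u) < n)%N.
Proof. by case: u => k t; rewrite /word_lt /= size_tuple. Qed.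

Lemma word_lt_inj : injective word_lt.
Proof.
case=> i s [j t]; rewrite /word_lt /= => st.
have ij : i = j by apply/val_inj; rewrite /= -(size_tuple s) st size_tuple.
by subst j; congr existT; apply/val_inj.
Qed.

Lemma word_lt_ex s : (size s < n)%N -> exists u, word_lt u = s.
Proof.
by move=> sn; exists (existT (fun k : 'I_n => k.-tuple A) (Ordinal sn) (in_tuple s)).
Qed.

Lemma level_sumE (V : nmodType) (F : seq A -> V) :
  level_sum n F = \sum_(u : words_lt) F (word_lt u).
Proof. by rewrite /level_sum sig_big_dep. Qed.

End WordsUpTo.

Lemma exchange_level_sum (A : finType) (V : nmodType) m n (F : seq A -> seq A -> V) :
  level_sum m (fun s => level_sum n (F s)) =
  level_sum n (fun t => level_sum m (fun s => F s t)).
Proof.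
rewrite !level_sumE; under eq_bigr do rewrite level_sumE.
by rewrite exchange_big; apply: eq_bigr => t _; rewrite level_sumE.
Qed.

Lemma eq_level_sum_in (A : finType) (V : nmodType) n (F G : seq A -> V) :
  (forall s, (size s < n)%N -> F s = G s) -> level_sum n F = level_sum n G.
Proof.
by move=> FG; rewrite !level_sumE; apply: eq_bigr => u _; rewrite FG ?size_word_lt.
Qed.

Lemma big_enum_val_type (T : finType) (V : nmodType) (F : T -> V) :
  \sum_x F x = \sum_(i < #|{: T}|) F (enum_val i).
Proof. by rewrite -big_enum_val; apply: eq_bigl => x; rewrite inE. Qed.

(** Orthonormality says that the matrix of the [ip (y u) t] is a right inverse of [a]. For finite
    square matrices it is then a left inverse too, which expresses each [y u] through the [q t]. *)
Lemma dual_expansion (K : comNzRingType) (V : lmodType K) (T : finType)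
    (y q : T -> V) (ip : V -> T -> K) (a : T -> T -> K) (c : T -> K) (v : V) :
  (forall x x' t, ip (x + x') t = ip x t + ip x' t) ->
  (forall b x t, ip (b *: x) t = b * ip x t) ->
  (forall s, q s = \sum_u a s u *: y u) ->
  (forall s t, ip (q s) t = (s == t)%:R) ->
  v = \sum_u c u *: y u -> v = \sum_t ip v t *: q t.
Proof.
move=> ipD ipZ qE ipq vE.
have ip_sum (b : T -> K) t : ip (\sum_u b u *: y u) t = \sum_u b u * ip (y u) t.
  rewrite (big_morph (fun x => ip x t) (id1 := 0) (op1 := +%R)) //.
    by apply: eq_bigr => u _; rewrite ipZ.
  by have := ipZ 0 0 t; rewrite scale0r mul0r.
have inv := fin_left_inverse (a := a) (b := fun u t => ip (y u) t).
have {}inv s t : \sum_u ip (y s) u * a u t = (s == t)%:R.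
  by apply: inv => {}s {}t; rewrite -ip_sum -qE ipq.
rewrite [LHS]vE; under [RHS]eq_bigr do rewrite {1}vE ip_sum qE.
have coefE u w : \sum_t (c u * ip (y u) t * a t w) *: y w
    = (c u * (u == w)%:R) *: y w.
  rewrite -inv mulr_sumr scaler_suml; apply: eq_bigr => t _.
  by rewrite mulrA.
transitivity (\sum_u \sum_w \sum_t (c u * ip (y u) t * a t w) *: y w).
  apply: eq_bigr => u _; under eq_bigr do rewrite coefE.
  rewrite (bigD1 u) //= eqxx mulr1 big1 ?addr0 // => w.
  by rewrite eq_sym => /negPf ->; rewrite mulr0 scale0r.
under [RHS]eq_bigr do rewrite scaler_sumr.
rewrite [RHS]exchange_big [LHS]exchange_big; apply: eq_bigr => w _.
rewrite exchange_big; apply: eq_bigr => t _.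
by rewrite scalerA mulr_suml scaler_suml.
Qed.

Lemma monomial_expansion (R : realType) (d n : nat) (P : ncpoly R d) :
  degree_le n P ->
  P = \sum_(u : words_lt 'I_d.+1 n.+1)
    mcoeff (FMonom (word_lt u)) P *: @ncmon R d (word_lt u) 1.
Proof.
move=> hP; apply/malgP => -[s]; rewrite raddf_sum /=.
have termE (u : words_lt 'I_d.+1 n.+1) :
    mcoeff (FMonom s) (mcoeff (FMonom (word_lt u)) P *: @ncmon R d (word_lt u) 1)
    = mcoeff (FMonom (word_lt u)) P * (word_lt u == s)%:R.
  by rewrite ncmonZ mcoeff_ncmon mulr1 mulr_natr.
under eq_bigr do rewrite termE.
have [sn|ns] := leqP (size s) n.
  have [u us] := @word_lt_ex _ n.+1 s sn.
  rewrite (bigD1 u) //= us eqxx mulr1 big1 ?addr0 // => w wu.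
  by rewrite -us (inj_eq (@word_lt_inj _ _)) (negPf wu) mulr0.
rewrite big1 => [|u _].
  by apply/eqP; apply: contraTT ns => /hP; rewrite -leqNgt.
case: eqP => [us|_]; last exact: mulr0.
by have := size_word_lt u; rewrite us ltnS leqNgt ns.
Qed.

(* Only the terms that cross between levels [n] and [n.+1] do not cancel. *)
Lemma banded_commutator (R : realType) (E : hilbertType R) (A : finType)
    (M : seq A -> seq A -> R[i]) (e f : seq A -> bop E E) (X X' : bop E E) (n : nat) :
  (forall s, (size s <= n)%N -> X * e s = level_sum n.+2 (fun t => M t s *: e t)) ->
  (forall s, (size s <= n)%N -> f s * X' = level_sum n.+2 (fun t => M s t *: f t)) ->
  (forall s t, ((size s).+1 < size t)%N -> M t s = 0) ->
  (forall s t, ((size s).+1 < size t)%N -> M s t = 0) ->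
  X * level_sum n.+1 (fun s => e s * f s) - level_sum n.+1 (fun s => e s * f s) * X' =
  \sum_(t : n.+1.-tuple A) \sum_(s : n.-tuple A) M t s *: (e t * f s)
  - \sum_(s : n.-tuple A) \sum_(t : n.+1.-tuple A) M s t *: (e s * f t).
Proof.
move=> hX hX' M0 M0'.
have top (G : seq A -> seq A -> bop E E) :
    (forall s t, ((size s).+1 < size t)%N -> G t s = 0) ->
    level_sum n.+1 (fun s => level_sum n.+2 (fun t => G t s)) =
    level_sum n.+1 (fun s => level_sum n.+1 (fun t => G t s))
    + \sum_(s : n.-tuple A) \sum_(t : n.+1.-tuple A) G t s.
  move=> G0.
  rewrite (eq_level_sum _ (G := fun s => level_sum n.+1 (fun t => G t s)
    + \sum_(t : n.+1.-tuple A) G t s)); last by move=> s; rewrite level_sum_recr.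
  rewrite level_sumD; congr (_ + _).
  rewrite level_sum_recr (eq_level_sum_in (G := fun=> 0)).
    by rewrite {1}/level_sum big1 ?add0r // => k _; rewrite big1.
  by move=> s sn; rewrite big1 // => t _; rewrite G0 // size_tuple ltnS.
rewrite -(level_sum_morph (h := *%R X)) ?mulr0 //; last exact: mulrDr.
rewrite -(level_sum_morph (h := fun T => T * X')) ?mul0r //; last first.
  by move=> S T; exact: mulrDl.
rewrite (eq_level_sum_in (G := fun s => level_sum n.+2 (fun t => M t s *: (e t * f s)))).
  rewrite (eq_level_sum_in (F := fun s => e s * f s * X')
    (G := fun s => level_sum n.+2 (fun t => M s t *: (e s * f t)))).
    rewrite !top => [|s t /M0' ->|s t /M0 ->]; rewrite ?scale0r //.
    (* After exchanging the sums, the parts over pairs of words of length at most [n] coincide and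
       cancel. *)
    rewrite opprD addrACA exchange_level_sum subrr add0r; congr (_ - _).
    exact: exchange_big.
  move=> s sn; rewrite -mulrA hX' // -(level_sum_morph (h := *%R (e s))) ?mulr0 //.
    by apply: eq_level_sum => t; rewrite scale_bopAr.
  exact: mulrDr.
move=> s sn; rewrite mulrA hX // -(level_sum_morph (h := fun T => T * f s)) ?mul0r //.
  by apply: eq_level_sum => t; rewrite scale_bopAl.
by move=> S T; exact: mulrDl.
Qed.

Lemma level_sum_adj (R : realType) (E : hilbertType R) (A : finType) n
    (F : seq A -> bop E E) :
  adj (level_sum n F) = level_sum n (fun s => adj (F s)).
Proof.
by rewrite -(level_sum_morph (h := @adj R E E)) //; [exact: adj0 | exact: adjD].
Qed.

(** * Orthogonal polynomials and multiplication by the last variable *)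

Section OrthogonalExpansion.
Variables (R : realType) (d : nat) (phi : {scalar (ncpoly R d)}).
Local Notation C := R[i].
Implicit Types (P Q : ncpoly R d).

Lemma ncipDl P P' Q : ncip phi (P + P') Q = ncip phi P Q + ncip phi P' Q.
Proof. by rewrite /ncip (mulrDr (ncinv Q) P P'); exact: linearD. Qed.

Lemma ncip0l Q : ncip phi 0 Q = 0.
Proof. by rewrite /ncip (mulr0 (ncinv Q)); exact: linear0. Qed.

Lemma ncipZl a P Q : ncip phi (a *: P) Q = a * ncip phi P Q.
Proof. by rewrite /ncip (ncpoly_scalerAr a (ncinv Q) P); exact: linearZ. Qed.

Lemma ncipDr P Q Q' : ncip phi P (Q + Q') = ncip phi P Q + ncip phi P Q'.
Proof.
by rewrite /ncip (ncinvD Q Q') (mulrDl (ncinv Q) (ncinv Q') P); exact: linearD.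
Qed.

Lemma ncipZr a P Q : ncip phi P (a *: Q) = a^* * ncip phi P Q.
Proof.
by rewrite /ncip (ncinvZ a Q) -(scalerAl a^* (ncinv Q) P); exact: linearZ.
Qed.

Lemma ncip_suml (I : Type) (r : seq I) (F : I -> ncpoly R d) Q :
  ncip phi (\sum_(i <- r) F i) Q = \sum_(i <- r) ncip phi (F i) Q.
Proof.
apply: (big_morph (fun P => ncip phi P Q)) => [P P'|]; first exact: ncipDl.
exact: ncip0l.
Qed.

(** Multiplication by Y_i is symmetric because the involution fixes Y_i and reverses products. *)
Lemma ncip_YmonM i P Q :
  ncip phi (Ymon R [:: i] * P) Q = ncip phi P (Ymon R [:: i] * Q).
Proof.
apply: (etrans (congr1 phi (mulrA (ncinv Q) (Ymon R [:: i]) P))).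
exact: (congr1 (fun X => phi (X * P)) (esym (ncinv_YmonM i Q))).
Qed.

Hypothesis phi_pos : strictly_positive_unital phi.

Lemma ncip_real P : (ncip phi P P)^* = ncip phi P P.
Proof.
have [_ pos] := phi_pos.
case: (eqVneq P 0) => [->|P0]; first by rewrite ncip0l rmorph0.
by rewrite geC0_conj // ltW // pos.
Qed.

Lemma ncip_herm P Q : ncip phi P Q = (ncip phi Q P)^*.
Proof.
apply: (@sesquilinear_real_herm C (ncpoly R d) (ncip phi)).
- exact: ncipDl.
- exact: ncipDr.
- exact: ncipZl.
- exact: ncipZr.
- exact: ncip_real.
Qed.

Variable p : seq 'I_d.+1 -> ncpoly R d.
Hypothesis p_orth : orthogonal_polys phi p.

Lemma degree_le_orth n s : (size s <= n)%N -> degree_le n (p s).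
Proof.
move=> sn t; have [h _ _] := p_orth; move/h => /orP[/ltnW|/andP[/eqP -> _]] //.
by move/leq_trans; apply.
Qed.

Lemma orthonormal_expansion n P : degree_le n P ->
  P = level_sum n.+1 (fun s => ncip phi P (p s) *: p s).
Proof.
move=> hP; rewrite level_sumE.
have [_ _ orth] := p_orth.
apply: (@dual_expansion C (ncpoly R d) (words_lt 'I_d.+1 n.+1)
  (fun u => @ncmon R d (word_lt u) 1) (fun u => p (word_lt u))
  (fun Q u => ncip phi Q (p (word_lt u)))
  (fun s u => mcoeff (FMonom (word_lt u)) (p (word_lt s)))
  (fun u => mcoeff (FMonom (word_lt u)) P)).
- by move=> Q Q' u; exact: ncipDl.
- by move=> a Q u; exact: ncipZl.
- move=> s; apply: monomial_expansion; apply: degree_le_orth.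
  by rewrite -ltnS size_word_lt.
- by move=> s t; rewrite orth (inj_eq (@word_lt_inj _ _)).
- exact: monomial_expansion.
Qed.

(** The matrix of multiplication by Y_N in the orthonormal polynomials. From level n, its blocks to
    levels n + 1, n and n - 1 are B_n, A_n and B_(n-1)^*. *)
Definition mulY_coef (t s : seq 'I_d.+1) : C :=
  ncip phi (Ymon R [:: ord_max] * p s) (p t).

Lemma mulY_expansion n s : (size s <= n)%N -> Ymon R [:: ord_max] * p s =
  level_sum n.+2 (fun t => mulY_coef t s *: p t).
Proof. by move=> sn; apply/orthonormal_expansion/degree_le_YmonM/degree_le_orth. Qed.

Lemma mulY_coef_herm s t : mulY_coef t s = (mulY_coef s t)^*.
Proof.
exact: (etrans (ncip_YmonM ord_max (p s) (p t)) (ncip_herm _ _)).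
Qed.

(** Y_N phi_s has degree at most |s| + 1, hence expands in polynomials phi_u of that level or below,
    all orthogonal to phi_t. Hermitian symmetry gives the vanishing on the other side of the
    band. *)
Lemma mulY_coef_eq0 s t : ((size s).+1 < size t)%N -> mulY_coef t s = 0.
Proof.
move=> st; rewrite /mulY_coef; have [_ _ orth] := p_orth.
rewrite (mulY_expansion (leqnn _)) level_sumE ncip_suml big1 // => u _.
rewrite ncipZl orth; case: eqP => [ut|_]; last exact: mulr0.
by have := size_word_lt u; rewrite ut ltnS leqNgt st.
Qed.

Lemma nceval_level_sum (E : hilbertType R) (W : 'I_d.+1 -> bop E E) n
    (F : seq 'I_d.+1 -> ncpoly R d) :
  nceval (level_sum n F) W = level_sum n (fun s => nceval (F s) W).
Proof.
rewrite -(level_sum_morph (h := fun P => nceval P W)) //; first exact: nceval0.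
by move=> P Q; exact: ncevalD.
Qed.

Lemma mulY_nceval (E : hilbertType R) (W : 'I_d.+1 -> bop E E) n s :
  (size s <= n)%N -> W ord_max * nceval (p s) W =
  level_sum n.+2 (fun t => mulY_coef t s *: nceval (p t) W).
Proof.
move=> sn; rewrite -nceval_YmonM (mulY_expansion sn) nceval_level_sum.
by apply: eq_level_sum => t; exact: ncevalZ.
Qed.

(** Operator form of the classical Christoffel-Darboux formula: the scalar factor x - conj(y)
    becomes left multiplication by W_N minus right multiplication by W'_N^*. *)
Lemma christoffel_darboux (E : hilbertType R) (W W' : 'I_d.+1 -> bop E E) n :
  W ord_max * CDkernel p n W W' - CDkernel p n W W' * adj (W' ord_max) =
  \sum_(t : n.+1.-tuple 'I_d.+1) \sum_(s : n.-tuple 'I_d.+1)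
    mulY_coef t s *: (nceval (p t) W * adj (nceval (p s) W'))
  - \sum_(s : n.-tuple 'I_d.+1) \sum_(t : n.+1.-tuple 'I_d.+1)
    mulY_coef s t *: (nceval (p s) W * adj (nceval (p t) W')).
Proof.
apply: (@banded_commutator R E _ mulY_coef (fun s => nceval (p s) W)
  (fun s => adj (nceval (p s) W'))).
- by move=> s sn; exact: mulY_nceval.
- move=> s sn; rewrite -adjM (mulY_nceval W' sn) level_sum_adj.
  by apply: eq_level_sum => t; rewrite adjZ -mulY_coef_herm.
- exact: mulY_coef_eq0.
- by move=> s t st; rewrite mulY_coef_herm mulY_coef_eq0 // rmorph0.
Qed.

Lemma Phi_Bmx_Phi (E : hilbertType R) (W W' : 'I_d.+1 -> bop E E) n :
  (PhiRow p n.+1 W *m ampl E (Bmx phi p n) *m adjmx (PhiRow p n W')) ord0 ord0 =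
  \sum_(t : n.+1.-tuple 'I_d.+1) \sum_(s : n.-tuple 'I_d.+1)
    mulY_coef t s *: (nceval (p t) W * adj (nceval (p s) W')).
Proof.
rewrite mxE exchange_big /= [RHS]big_enum_val_type; apply: eq_bigr => j _.
rewrite mxE mulr_suml [RHS]big_enum_val_type; apply: eq_bigr => i _.
by rewrite !mxE scale_bopAr mulr1 scale_bopAl.
Qed.

Lemma Phi_Bmx_adj_Phi (E : hilbertType R) (W W' : 'I_d.+1 -> bop E E) n :
  (PhiRow p n W *m ampl E (map_mx Num.conj (Bmx phi p n))^T
    *m adjmx (PhiRow p n.+1 W')) ord0 ord0 =
  \sum_(s : n.-tuple 'I_d.+1) \sum_(t : n.+1.-tuple 'I_d.+1)
    mulY_coef s t *: (nceval (p s) W * adj (nceval (p t) W')).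
Proof.
rewrite mxE exchange_big /= [RHS]big_enum_val_type; apply: eq_bigr => j _.
rewrite mxE mulr_suml [RHS]big_enum_val_type; apply: eq_bigr => i _.
rewrite !mxE scale_bopAr mulr1 scale_bopAl; congr (_ *: _).
by rewrite [RHS]mulY_coef_herm.
Qed.

End OrthogonalExpansion.


Theorem theorem8 (R : realType) (E : hilbertType R) (E_inf : infinite_dim E)
    (d : nat) (phi : {scalar (ncpoly R d)})
    (phi_pos : strictly_positive_unital phi)
    (p : seq 'I_d.+1 -> ncpoly R d) (p_orth : orthogonal_polys phi p)
    (n : nat) (W W' : 'I_d.+1 -> bop E E) (hW : siegel W) (hW' : siegel W') :
  CDkernel p n W W' =
    Fop W
      ∘ diag_op 'I_d.+1
          ((2 * 'i)^-1 *:
            (PhiRow p n.+1 W *m ampl E (Bmx phi p n) *m adjmx (PhiRow p n W')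
             - PhiRow p n W *m ampl E (map_mx Num.conj (Bmx phi p n))^T
               *m adjmx (PhiRow p n.+1 W')) ord0 ord0)
      ∘ adj (Fop W')
    - \sum_(k | k != ord_max)
        (Fop W ∘ diag_op 'I_d.+1 (W k * CDkernel p n W W' * adj (W' k))
           ∘ adj (Fop W')).
Proof.
set L := fun_of_matrix _ ord0 ord0.
have -> : L = W ord_max * CDkernel p n W W' - CDkernel p n W W' * adj (W' ord_max).
  rewrite /L mxE [X in _ + X]mxE Phi_Bmx_Phi (Phi_Bmx_adj_Phi phi_pos).
  exact/esym/(christoffel_darboux phi_pos p_orth).
(* The kernel identity at K = K_n(W, W') is already the claim with a single diagonal operator; it
   remains to distribute [Fop W] over its difference and sum. *)
rewrite -[LHS](Fop_kernel_identity hW hW') diag_opB diag_op_sum.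
apply: bopP => x; set r := Fop W; set r' := adj (Fop W') x.
set D := diag_op _ (_ *: _).
pose Q k := diag_op 'I_d.+1 (W k * CDkernel p n W W' * adj (W' k)).
rewrite -[LHS]/(r (D r' - (\sum_(k | k != ord_max) Q k) r')).
rewrite -[RHS]/(r (D r') - (\sum_(k | k != ord_max) r ∘ Q k ∘ adj (Fop W')) x).
rewrite bopB !bop_sumE linear_sum.
by congr (_ - _).
Qed.
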